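(* Let $k\le\ell$, $m\in\mathbb{N}^k$ and $n\in\mathbb{N}^\ell$. Then $q(K_m\vee K_n)=2$ if and only if one of the following holds: (a) $\iota(m)=0$, $\iota(n)=0$ and $\ell\le|m|$; (b) $\iota(m)>0$ and $k+\ell\le|m|+\iota(m)$; (c) $\iota(m)=0$, $\iota(n)>0$, and either $k+\ell\le|m|$, or $2k\le\ell\le|m|$, or $\ell\le 2k\le|n|$. Otherwise $q(K_m\vee K_n)=3$.
   Context: For $m=(m_1,\dots,m_k)\in\mathbb{N}^k$: $K_m=\bigcup_{i=1}^kK_{m_i}$ (disjoint union of complete graphs), $|m|=\sum_im_i$, and $\iota(m)=|\{i:m_i=1\}|$. $G\vee H$ is the join. $S(G)$ is the set of real symmetric matrices whose off-diagonal nonzero pattern is the edge set of $G$; $q(G)$ is the minimum number of distinct eigenvalues of a matrix in $S(G)$. *)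

(* Defs.v *)
From mathcomp Require Import all_boot all_order all_algebra finmap.
From mathcomp Require Import all_classical all_reals.

Set Implicit Arguments.
Unset Strict Implicit.
Unset Printing Implicit Defensive.

Import GRing.Theory Num.Theory.

Record sgraph := SGraph {
  vertex :> finType;
  adj : rel vertex;
  adj_sym : symmetric adj;
  adj_irr : irreflexive adj
}.

Definition complete_adj (n : nat) : rel 'I_n := fun x y => x != y.

Lemma complete_sym (n : nat) : symmetric (@complete_adj n).
Proof. by move=> x y; rewrite /complete_adj eq_sym. Qed.

Lemma complete_irr (n : nat) : irreflexive (@complete_adj n).
Proof. by move=> x; rewrite /complete_adj eqxx. Qed.

Definition complete_graph (n : nat) : sgraph :=
  SGraph (@complete_sym n) (@complete_irr n).

(* When tag u == tag v, tagged_as u v is tagged v transported to G (tag u). *)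
Definition dunion_adj (I : finType) (G : I -> sgraph) : rel {i : I & G i} :=
  fun u v => (tag u == tag v) && adj (tagged u) (tagged_as u v).

Lemma dunion_sym (I : finType) (G : I -> sgraph) :
  symmetric (@dunion_adj I G).
Proof.
move=> [i x] [j y]; rewrite /dunion_adj /= eq_sym.
case: eqP => //= eji; move: y; rewrite eji => y.
by rewrite !tagged_asE adj_sym.
Qed.

Lemma dunion_irr (I : finType) (G : I -> sgraph) :
  irreflexive (@dunion_adj I G).
Proof. by move=> [i x]; rewrite /dunion_adj /= eqxx tagged_asE adj_irr. Qed.

Definition disjoint_union (I : finType) (G : I -> sgraph) : sgraph :=
  SGraph (@dunion_sym I G) (@dunion_irr I G).

Definition join_adj (G H : sgraph) : rel (G + H)%type := fun u v =>
  match u, v with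
  | inl x, inl y => adj x y
  | inr x, inr y => adj x y
  | _, _ => true
  end.

Lemma join_sym (G H : sgraph) : symmetric (@join_adj G H).
Proof. by move=> [x|x] [y|y] //=; rewrite adj_sym. Qed.

Lemma join_irr (G H : sgraph) : irreflexive (@join_adj G H).
Proof. by move=> [x|x] /=; rewrite adj_irr. Qed.

Definition graph_join (G H : sgraph) : sgraph :=
  SGraph (@join_sym G H) (@join_irr G H).

Definition union_complete (k : nat) (m : 'I_k -> nat) : sgraph :=
  disjoint_union (fun i => complete_graph (m i)).

Definition weight (k : nat) (m : 'I_k -> nat) : nat := \sum_(i < k) m i.

Definition num_ones (k : nat) (m : 'I_k -> nat) : nat :=
  #|[set i | m i == 1%N]%SET|.

Local Open Scope classical_set_scope.
Local Open Scope ring_scope.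

(* Rows and columns are indexed by the vertices through enum_val; the diagonal
   is unconstrained. *)
Definition graph_matrices (R : realType) (G : sgraph) : set 'M[R]_#|G| :=
  [set A | A^T = A /\
    forall i j, i != j -> (A i j != 0) = adj (enum_val i) (enum_val j)].

Arguments graph_matrices : clear implicits.

Definition spectrum (R : realType) (N : nat) (A : 'M[R]_N) : set R :=
  [set a | eigenvalue A a].

(* fset_set is the finite set underlying a finite set, and fset0 on infinite
   ones; finite_spectrum shows that the latter case does not occur. *)
Definition num_eigenvalues (R : realType) (N : nat) (A : 'M[R]_N) : nat :=
  #|` fset_set (spectrum A)|.

Lemma finite_spectrum (R : realType) (N : nat) (A : 'M[R]_N) :
  finite_set (spectrum A).
Proof.
have p0 : char_poly A != 0 by rewrite monic_neq0 // char_poly_monic.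
have [s Hs] : exists s : seq R, forall a, root (char_poly A) a -> a \in s.
  elim: {A} (size (char_poly A)) {-2}(char_poly A) (leqnn (size (char_poly A)))
    p0 => [|d IH] p sp p0.
    by move: sp; rewrite leqn0 size_poly_eq0 (negbTE p0).
  have [[a ra]|nr] := pselect (exists a, root p a); last first.
    by exists [::] => a ra; case: nr; exists a.
  have /factor_theorem[r pE] := ra.
  have r0 : r != 0 by apply: contraNneq p0 => r0; rewrite pE r0 mul0r.
  have [|s Hs] := IH r _ r0.
    by move: sp; rewrite pE size_Mmonic ?monicXsubC // size_XsubC addn2.
  exists (a :: s) => b; rewrite pE rootM root_XsubC inE => /orP[/Hs ->|->//].
  by rewrite orbT.
apply: (sub_finite_set _ (finite_seq s)) => a.
by rewrite /spectrum /= eigenvalue_root_char => /Hs.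
Qed.

Definition attains_num_eigenvalues (R : realType) (G : sgraph) : pred nat :=
  fun r => `[< exists2 A, graph_matrices R G A & num_eigenvalues A = r >].

Lemma attains_num_eigenvalues_ex (R : realType) (G : sgraph) :
  exists r, attains_num_eigenvalues R G r.
Proof.
pose A : 'M[R]_#|G| := \matrix_(i, j) (adj (enum_val i) (enum_val j))%:R.
exists (num_eigenvalues A); apply/asboolP; exists A => //; split.
  by apply/matrixP => i j; rewrite !mxE adj_sym.
by move=> i j _; rewrite mxE pnatr_eq0 eqb0 negbK.
Qed.

Definition min_num_eigenvalues (R : realType) (G : sgraph) : nat :=
  ex_minn (attains_num_eigenvalues_ex R G).

(* Main.v *)
Require Import Defs.
From mathcomp Require Import all_boot all_order all_algebra.
From mathcomp Require Import all_classical all_reals.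
From mathcomp Require Import finmap complex ring zify.

(** Since a symmetric matrix with two eigenvalues is affinely equivalent to a
symmetric involution, q = 2 means that some X with X^T = X and X^2 = 1 has the
pattern of the join. Let A_i, C_j be its diagonal blocks on the cliques of the
two sides and B_ij its blocks between the sides.

Necessity. If w is an eigenvector of A_i (extended by zero) for lam, the part
of X w on the other side is an eigenvector of the C_j's for - lam, and this
transfer multiplies the inner product of two eigenvectors for lam, mu by
1 - lam mu. As B_ij is nonzero, A_i and - C_j share an eigenvalue in the
interior of [-1, 1], so pairwise orthogonal interior eigenvectors on one side
transfer to independent ones on the other. If some A_i has a single interior
eigenvalue lam, each C_j has - lam, while the multiplicity of lam in A_i is
less than m_i unless m_i = 1: this gives l <= |m| - k + iota(m). Otherwise each
A_i has two interior eigenvalues, and 2k <= |n|.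

Sufficiency. It is enough to find an involution whose blocks between the sides
are nonzero, and whose diagonal blocks of size at least 2 are not scalar:
conjugating by reflections that mix two vertices of a clique makes all the
required entries nonzero. Such involutions are obtained with interior
eigenvalue 0, or with interior eigenvalues 3/5 and -3/5 alternating along the
cliques. The bound q <= 3 uses the same perturbation on a matrix satisfying
X^3 = beta^2 X. *)

Set Implicit Arguments.
Unset Strict Implicit.
Unset Printing Implicit Defensive.

Import Order.TTheory GRing.Theory Num.Theory.

(** * Distribution of the slots *)

(** The lower bounds are raised one unit at a time, at an index where they still lie below [hi],
    until their sum is [L]. *)
Lemma exists_sum_between (I : finType) (lo hi : I -> nat) L :
  (forall i, lo i <= hi i) -> \sum_i lo i <= L <= \sum_i hi i ->
  exists v : I -> nat, (forall i, lo i <= v i <= hi i) /\ \sum_i v i = L.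
Proof.
have [d] := ubnP (L - \sum_i lo i); elim: d lo => // d IHd lo led lohi /andP[loL Lhi].
have [eL|nL] := eqVneq (\sum_i lo i) L.
  by exists lo; split=> // i; rewrite leqnn lohi.
have [i lti] : exists i, lo i < hi i.
  apply/existsP; apply: contraNT nL => /existsPn le; rewrite eqn_leq loL.
  by apply: leq_trans Lhi _; apply: leq_sum => i _; rewrite leqNgt le.
pose lo' j := lo j + (j == i).
have sum' : \sum_j lo' j = (\sum_j lo j).+1.
  by rewrite big_split /= -[X in _ + X]big_mkcond /= big_pred1_eq addn1.
have [|||v [vb vL]] := IHd lo'.
- by rewrite sum'; lia.
- by move=> j; rewrite /lo'; case: eqP => [->|_]; rewrite ?addn1 ?addn0.
- by rewrite sum'; lia.
exists v; split=> // j; have := vb j; rewrite /lo'; lia.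
Qed.

(* Slots are numbered clique after clique, so that a clique with two slots has
   slots of both parities. *)
Lemma exists_slots k (m v : 'I_k -> nat) L :
  (forall i, v i <= m i) -> \sum_i v i = L ->
  exists f : 'I_L -> {i : 'I_k & 'I_(m i)}, injective f /\
    forall i, [/\ 0 < v i -> exists t, tag (f t) = i,
      1 < v i -> forall b, exists2 t, tag (f t) = i & odd t = b &
      v i < m i -> exists2 x, tag x = i & forall t, x != f t].
Proof.
move=> vm <-; pose T := {i : 'I_k & 'I_(m i)}.
pose F (x : {i : 'I_k & 'I_(v i)}) : T :=
  Tagged (fun i => 'I_(m i)) (widen_ord (vm (tag x)) (tagged x)).
have taggedI i (p q : 'I_(m i)) :
    Tagged (fun i => 'I_(m i)) p = Tagged (fun i => 'I_(m i)) q -> p = q.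
  by move=> /eqP; rewrite -tag_eqE /tag_eq eqxx tagged_asE => /eqP.
have F_inj : injective F.
  move=> [i p] [j q] E; have /= e1 := congr1 tag E; subst j.
  by have /(congr1 val) /= /val_inj-> := taggedI _ _ _ E.
pose f t := F (tagnat.sig t).
have fR i (p : 'I_(v i)) : f (@tagnat.Rank _ v i p) = F (Tagged _ p).
  by rewrite /f tagnat.rankK.
exists f; split=> [t t' /F_inj|i]; first exact: tagnat.sig_inj.
split=> [v0|v1 b|vlt].
- by exists (@tagnat.Rank _ v i (Ordinal v0)); rewrite fR.
- have v0 : 0 < v i by apply: ltnW.
  (* The slots of clique [i] are consecutive and start at the sum of the earlier [v j]; its first or
     second slot is taken according to the parity of that sum. *)
  exists (@tagnat.Rank _ v i
    (if odd (\sum_(j < k | j < i) v j) (+) b then Ordinal v1 else Ordinal v0)).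
    by rewrite fR.
  by rewrite tagnat.RankEsum oddD; case: (odd (\sum_(j < k | _) _)) b => [] [].
- exists (Tagged (fun i => 'I_(m i)) (Ordinal vlt)) => // t; apply/eqP.
  rewrite /f; case: (tagnat.sig t) => j p E; have /= e1 := congr1 tag E; subst j.
  have /(congr1 val) /= ev := taggedI _ _ _ E.
  by have := ltn_ord p; rewrite -ev ltnn.
Qed.

Local Open Scope ring_scope.

(** * Eigenvectors of symmetric matrices *)

(** Over [R[i]] the spectral theorem gives a unitary diagonalization with real eigenvalues.
    Extension of scalars preserves the minimal polynomial, which therefore divides a product of
    distinct linear factors over [R]. *)
Lemma symmetric_diagonalizable (R : rcfType) n (A : 'M[R]_n) :
  A^T = A -> mxpoly.diagonalizable A.
Proof.
case: n A => [|n] A symA.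
  apply/mxpoly.diagonalizablePeigen; exists [::] => //.
  by rewrite big_nil; apply/eqmxP; rewrite sub0mx thinmx0 sub0mx.
pose f := real_complex R; pose B := map_mx f A.
have hB : B \is hermsymmx.
  apply: realsym_hermsym.
    by apply/is_hermitianmxP; rewrite expr0 scale1r map_mx_id // map_trmx symA.
  by apply/mxOverP => i j; rewrite mxE; apply/complex_realP; exists (A i j).
have /orthomx_spectralP BE := hermitian_normalmx hB.
have /mxOverP dR := hermitian_spectral_diag_real hB.
set P := spectralmx B in BE; set d := spectral_diag B in BE dR.
have Pu : P \in unitmx by exact: spectral_unit.
pose d' := map_mx (@complex.Re R) d.
have dE i : d 0 i = f (d' 0 i) by rewrite mxE /f RRe_real // dR.
have Bmin : mxminpoly B = mxminpoly (diag_mx d).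
  have -> : B = mxpoly.conjmx (invmx P) (diag_mx d).
    by rewrite mxpoly.conjumx ?unitmx_inv // invmxK.
  by rewrite mxpoly.mxminpoly_uconj // unitmx_inv.
apply/mxpoly.diagonalizableP; exists (undup [seq d' 0 i | i <- enum 'I_n.+1]).
  exact: undup_uniq.
rewrite -(dvdp_map f) -mxminpoly_map -/B Bmin mxminpoly_diag.
rewrite rmorph_prod /=; under [X in _ %| X]eq_bigr do rewrite rmorphB /= map_polyX map_polyC /=.
rewrite -(big_map f xpredT (fun x => 'X - x%:P)) -undup_map_inj; last exact: complexI.
by rewrite -(map_comp f) (eq_map dE) enumT; apply: dvdpp.
Qed.

(** The eigenspaces span the whole space, so a nonzero [B] cannot annihilate all of them. *)
Lemma symmetric_eigenvectors_separate (R : rcfType) n p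
    (A : 'M[R]_n) (B : 'M[R]_(n, p)) :
  A^T = A -> B != 0 -> exists lam (w : 'rV_n), w *m A = lam *: w /\ w *m B != 0.
Proof.
move=> /symmetric_diagonalizable/mxpoly.diagonalizablePeigen[rs _ rsE] B0.
have [r _ rB] : exists2 r, r \in rs & eigenspace A r *m B != 0.
  apply/hasP; apply: contraNT B0 => /hasPn AB0.
  suff: ((1%:M : 'M_n) <= kermx B)%MS by move/sub_kermxP; rewrite mul1mx => ->.
  rewrite -rsE big_seq; elim/big_ind: _ => [|U V|r /AB0/negPn/eqP rB].
  - exact: sub0mx.
  - by rewrite addsmx_sub => -> ->.
  - exact/sub_kermxP.
have [i wB] : exists i, row i (eigenspace A r *m B) != 0.
  apply/existsP; apply: contraNT rB => /existsPn rB.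
  by apply/eqP/row_matrixP => i; rewrite row0; apply/eqP/negPn/rB.
exists r, (row i (eigenspace A r)); split; last by rewrite -row_mul.
by apply/eigenspaceP/row_sub.
Qed.

(** * Blocks of a join and generic conjugation *)

Lemma exists_nonroot (R : numDomainType) (p : {poly R}) :
  p != 0 -> exists t, p.[t] != 0.
Proof.
move=> p0; have rs_uniq : uniq [seq (i%:R : R) | i <- iota 0 (size p)].
  by rewrite map_inj_uniq ?iota_uniq //; apply: mulrIn; rewrite oner_eq0.
have := contraNN (fun x => max_poly_roots p0 x rs_uniq).
rewrite size_map size_iota ltnn => /(_ isT) /allPn[a _ pa].
by exists a.
Qed.

Section Blocks.
Context {R : realFieldType} {N : nat} {I : finType}.
Context (cl : 'I_N -> I) (side : I -> bool).
Implicit Types (i j : I) (X : 'M[R]_N).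

(** Blocks are padded with zeros to full size, as [clique_proj i *m X *m clique_proj j], so that
    blocks of all shapes multiply in one matrix algebra. *)
Definition clique_proj i : 'M[R]_N := diag_mx (\row_a (cl a == i)%:R).

Definition clique_size i : nat := #|[pred a | cl a == i]|.

Definition clique_adj (a b : 'I_N) :=
  (cl a == cl b) || (side (cl a) != side (cl b)).

Definition join_pattern X : Prop :=
  forall a b, a != b -> (X a b != 0) = clique_adj a b.

(* What survives of [join_pattern] under conjugation by an orthogonal matrix
   commuting with every [clique_proj i]. *)
Record block_pattern X : Prop := BlockPattern {
  block_eq0 : forall i j, i != j -> side i = side j ->
    clique_proj i *m X *m clique_proj j = 0;
  block_neq0 : forall i j, side i != side j ->
    clique_proj i *m X *m clique_proj j != 0;
  block_nonscalar : forall i lam, (1 < clique_size i)%N ->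
    clique_proj i *m X *m clique_proj i != lam *: clique_proj i }.

Lemma blockE i j X a b :
  (clique_proj i *m X *m clique_proj j) a b =
  if (cl a == i) && (cl b == j) then X a b else 0.
Proof.
rewrite /clique_proj mul_mx_diag mxE mul_diag_mx !mxE.
by do 2!case: eqP; rewrite ?mulr1 ?mulr0 ?mul1r ?mul0r.
Qed.

Lemma join_pattern_block X : (forall i, 0 < clique_size i)%N ->
  join_pattern X -> block_pattern X.
Proof.
move=> sz0 patX; split=> [i j nij sij|i j nij|i lam sz1].
- apply/matrixP => a b; rewrite blockE mxE; case: ifP => // /andP[/eqP ai /eqP bj].
  have nab : a != b by apply: contraNneq nij => eab; rewrite -ai eab bj.
  have := patX a b nab; rewrite /clique_adj ai bj sij (negbTE nij) eqxx /=.
  by move/eqP.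
- have /card_gt0P[a /eqP ai] := sz0 i; have /card_gt0P[b /eqP bj] := sz0 j.
  have nab : a != b by apply: contraNneq nij => eab; rewrite -ai eab bj.
  have := patX a b nab; rewrite /clique_adj ai bj nij orbT.
  apply: contraTneq => /matrixP/(_ a b); rewrite blockE ai bj !eqxx mxE /=.
  by move=> ->; rewrite eqxx.
- have /card_gt1P[a [b [/eqP ai /eqP bi nab]]] := sz1.
  have := patX a b nab; rewrite /clique_adj ai bi eqxx /=.
  apply: contraTneq => /matrixP/(_ a b).
  by rewrite blockE ai bi !eqxx !mxE (negbTE nab) mulr0n mulr0 /= => ->; rewrite eqxx.
Qed.

(** As [H] commutes with the projections, each padded block is conjugated on its own, and
    conjugating again recovers it. *)
Lemma block_pattern_conj X H : H *m H = 1%:M ->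
  (forall i, clique_proj i *m H = H *m clique_proj i) ->
  block_pattern X -> block_pattern (H *m X *m H).
Proof.
move=> HH HP [X0 Xn0 Xns].
have E i j : clique_proj i *m (H *m X *m H) *m clique_proj j =
             H *m (clique_proj i *m X *m clique_proj j) *m H.
  by rewrite !mulmxA HP -!mulmxA HP.
have HK Y : H *m (H *m Y *m H) *m H = Y.
  by rewrite !mulmxA HH mul1mx -mulmxA HH mulmx1.
split=> [i j nij sij|i j nij|i lam sz1]; rewrite E.
- by rewrite X0 // mulmx0 mul0mx.
- apply: contraNneq (Xn0 i j nij) => e0.
  by rewrite -[X in X == 0]HK e0 mulmx0 mul0mx.
- apply: contraNneq (Xns i lam sz1) => e0.
  rewrite -[X in X == _]HK e0 -scalemxAr -scalemxAl -HP.
  by rewrite -mulmxA HH mulmx1.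
Qed.

Definition plane_vector (p q : 'I_N) (t : R) : 'rV[R]_N :=
  delta_mx 0 q + t *: delta_mx 0 p.

(** The Householder reflection along [e_q + t e_p], a vector of squared norm [1 + t ^+ 2] when [p]
    and [q] differ. *)
Definition reflection p q t : 'M[R]_N :=
  1%:M - (2 / (1 + t ^+ 2)) *: ((plane_vector p q t)^T *m plane_vector p q t).

Let one_sqr_neq0 (t : R) : 1 + t ^+ 2 != 0.
Proof. by rewrite gt_eqF // ltr_pwDl // sqr_ge0. Qed.

Lemma plane_vectorE p q t a :
  plane_vector p q t 0 a = (a == q)%:R + t * (a == p)%:R.
Proof. by rewrite !mxE eqxx. Qed.

Lemma reflectionE p q t a b : reflection p q t a b =
  (a == b)%:R - 2 / (1 + t ^+ 2) *
    (((a == q)%:R + t * (a == p)%:R) * ((b == q)%:R + t * (b == p)%:R)).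
Proof. by rewrite !mxE big_ord1 mxE !plane_vectorE. Qed.

Lemma reflection_sym p q t : (reflection p q t)^T = reflection p q t.
Proof. by apply/matrixP => a b; rewrite mxE !reflectionE eq_sym [X in _ * X]mulrC. Qed.

Lemma reflectionK p q t : p != q ->
  reflection p q t *m reflection p q t = 1%:M.
Proof.
move=> npq; rewrite /reflection; set h := plane_vector p q t.
have hh : h *m h^T = (1 + t ^+ 2)%:M.
  rewrite [LHS]mx11_scalar; congr (_%:M); rewrite /h linearD /= linearZ /=.
  rewrite mulmxDl !mulmxDr -!scalemxAl -!scalemxAr !trmx_delta !mul_delta_mx_cond.
  rewrite !eqxx (negbTE npq) eq_sym (negbTE npq) !mxE eqxx.
  by rewrite /=; ring.
set c := (X in X *: _); set M := h^T *m h.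
have MM : M *m M = (1 + t ^+ 2) *: M.
  by rewrite /M mulmxA -(mulmxA h^T) hh mul_mx_scalar -scalemxAl.
rewrite mulmxBl mul1mx mulmxBr mulmx1 -scalemxAl -scalemxAr MM !scalerA.
rewrite opprB -[RHS]addr0 -addrA; congr (_ + _).
have -> : c * c * (1 + t ^+ 2) = c + c by rewrite /c; field; exact: one_sqr_neq0.
by rewrite scalerDl addrK addNr.
Qed.

Lemma reflection_proj p q t i : cl p = cl q ->
  clique_proj i *m reflection p q t = reflection p q t *m clique_proj i.
Proof.
move=> cpq; have := reflectionE p q t; move: (reflection p q t) => H HE.
apply/matrixP => a b; rewrite /clique_proj mul_diag_mx mul_mx_diag !mxE !HE.
have [->|nab] := eqVneq a b; first exact: mulrC.
have [cab|ncab] := eqVneq (cl a) (cl b); first by rewrite cab mulrC.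
suff -> : ((a == q)%:R + t * (a == p)%:R) * ((b == q)%:R + t * (b == p)%:R) = 0 :> R.
  by rewrite mulr0 subr0 mulr0 mul0r.
have z c : cl c != cl q -> (c == q)%:R + t * (c == p)%:R = 0 :> R.
  move=> ncq; have /negbTE-> : c != q by apply: contraNneq ncq => ->.
  have /negbTE-> : c != p by apply: contraNneq ncq => ->; rewrite cpq.
  by rewrite mulr0 addr0.
have [eaq|/z->] := eqVneq (cl a) (cl q); last by rewrite mul0r.
by rewrite [X in _ * X]z ?mulr0 // -eaq eq_sym.
Qed.

Definition num_nonzero X := #|[pred u : 'I_N * 'I_N | X u.1 u.2 != 0]|.

(* The entries of [H X H], cleared of denominators, are polynomials in [t];
   at [t = 0] they are the entries of [X] up to sign, so for a suitable [t] no nonzero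
   entry is lost while the prescribed one is gained. *)
Lemma reflection_gains X p q a b t0 :
  let H t := reflection p q t in
  X a b = 0 -> (H t0 *m X *m H t0) a b != 0 ->
  exists t, (num_nonzero X < num_nonzero (H t *m X *m H t))%N.
Proof.
move=> H Xab HXH.
pose h a : {poly R} := ((a == q)%:R)%:P + 'X * ((a == p)%:R)%:P.
pose K a b : {poly R} := ((a == b)%:R)%:P * (1%:P + 'X ^+ 2) - 2%:P * (h a * h b).
pose F a b := \sum_c (\sum_d K a d * (X d c)%:P) * K c b.
have KE c d t : (K c d).[t] = (1 + t ^+ 2) * H t c d.
  rewrite /K !(hornerD, hornerN, hornerM, hornerX, hornerC) /H reflectionE.
  by field; exact: one_sqr_neq0.
have mulmxE (A B : 'M[R]_N) c d : (A *m B) c d = \sum_e A c e * B e d by rewrite mxE.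
have FE c d t : (F c d).[t] = (1 + t ^+ 2) ^+ 2 * (H t *m X *m H t) c d.
  rewrite /F horner_sum mulmxE mulr_sumr; apply: eq_bigr => e _.
  rewrite hornerM KE horner_sum mulmxE !mulr_suml mulr_sumr; apply: eq_bigr => f _.
  by rewrite hornerM KE hornerC; ring.
have F0 c d : X c d != 0 -> (F c d).[0] != 0.
  have H0 e f : H 0 e f = if e == f then (-1) ^+ (e == q) else 0.
    rewrite /H reflectionE !mul0r !addr0 expr0n addr0 divr1.
    have [<-|nef] := eqVneq e f; first by case: (e == q); rewrite /=; ring.
    have [eq|_] := eqVneq e q; last by rewrite mul0r mulr0 subr0.
    by rewrite -eq eq_sym (negbTE nef) !mulr0 subr0.
  suff -> : (F c d).[0] = (-1) ^+ (c == q) * (X c d) * (-1) ^+ (d == q).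
    by move=> Xcd; rewrite !mulf_neq0 ?signr_eq0.
  rewrite FE expr0n addr0 expr1n mul1r mulmxE (bigD1 d) //= big1 => [|e ned].
    rewrite H0 eqxx addr0 mulmxE (bigD1 c) //= big1 ?H0 ?eqxx ?addr0 // => e nec.
    by rewrite H0 eq_sym (negbTE nec) mul0r.
  by rewrite H0 (negbTE ned) mulr0.
(* A single [t] has to serve all entries of [U] at once: a nonroot of the product of their
   polynomials. *)
pose u0 := (a, b); pose U := [pred u | (X u.1 u.2 != 0) || (u == u0)].
have /exists_nonroot[t] : \prod_(u | U u) F u.1 u.2 != 0.
  apply/prodf_neq0 => u /orP[/F0|/eqP->]; first by apply: contraNneq => ->; rewrite horner0.
  have : (F a b).[t0] != 0 by rewrite FE mulf_neq0 // expf_neq0 // one_sqr_neq0.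
  by apply: contraNneq => ->; rewrite horner0.
rewrite horner_prod => /prodf_neq0 Ft; exists t; apply: proper_card.
have XF u : U u -> (H t *m X *m H t) u.1 u.2 != 0.
  by move=> /Ft; rewrite FE; apply: contraNneq => ->; rewrite mulr0.
apply/properP; split.
  by apply/fintype.subsetP => u; rewrite !inE => Xu; apply: XF; rewrite /U /= Xu.
by exists u0; rewrite !inE /= ?Xab ?eqxx // -[_ a b]/(_ u0.1 u0.2) XF // /U /= eqxx orbT.
Qed.

(* If no reflection mixing two vertices of a clique gains an entry, the zero
   entries are stable under such mixing: a zero in a block between the two
   sides spreads to the whole block, and an off-diagonal zero in a clique
   spreads to all its off-diagonal entries and then equates its diagonal
   entries. *)
Lemma stable_zeros_join_pattern X : X^T = X -> block_pattern X ->
  (forall p q a b, p != q -> cl p = cl q -> X a b = 0 ->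
    (reflection p q 2 *m X *m reflection p q 2) a b = 0) ->
  join_pattern X.
Proof.
move=> symX [X0 Xn0 Xns] stab.
have XT a b : X a b = X b a by rewrite -[X in LHS]symX mxE.
have Hrow p q a c : a != p -> a != q -> reflection p q 2 a c = (a == c)%:R.
  by move=> /negbTE ap /negbTE aq; rewrite reflectionE ap aq !mulr0 addr0 mul0r mulr0 subr0.
have mulmxE (A B : 'M[R]_N) c d : (A *m B) c d = \sum_e A c e * B e d by rewrite mxE.
have five_neq0 : (1 + 2 ^+ 2 : R) != 0 by exact: one_sqr_neq0.
(* In row [a] the reflection only mixes columns [p] and [q]; as [X a q = 0], entry [(a, q)] of the
   conjugate is [-4/5] times [X a p]. *)
have spread a p q : a != p -> a != q -> cl p = cl q -> X a q = 0 -> X a p = 0.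
  move=> ap aq cpq Xaq; have [->//|npq] := eqVneq p q.
  have := stab p q a q npq cpq Xaq; rewrite mulmxE.
  have XH e : (reflection p q 2 *m X) a e = X a e.
    rewrite mulmxE (bigD1 a) //= Hrow // eqxx mul1r big1 ?addr0 // => f nfa.
    by rewrite Hrow // eq_sym (negbTE nfa) mul0r.
  rewrite (bigD1 p) //= (bigD1 q) 1?eq_sym //= big1 => [|e /andP[ep eq]].
    rewrite !XH Xaq mul0r !addr0 reflectionE (negbTE npq) !eqxx (eq_sym q) (negbTE npq).
    move=> /eqP; rewrite mulf_eq0 => /orP[/eqP//|].
    suff /negbTE-> : (0%:R - 2 / (1 + 2 ^+ 2) *
        ((0%:R + 2 * 1%:R) * (1%:R + 2 * 0%:R)) : R) != 0 by [].
    rewrite !(mulr0n, mulr1n, mulr0, mulr1, addr0, add0r) oppr_eq0.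
    by rewrite !mulf_neq0 ?invr_eq0 // pnatr_eq0.
  by rewrite Hrow // (negbTE eq) mulr0.
move=> a b nab; apply/idP/idP.
  apply: contraNT; rewrite negb_or negbK => /andP[ncl /eqP sd].
  have /matrixP/(_ a b) := X0 _ _ ncl sd.
  by rewrite blockE !eqxx mxE /= => ->.
rewrite /clique_adj; have [cab _|ncab /= nsd] := eqVneq (cl a) (cl b); apply/negP => /eqP Xab.
  have sz : (1 < clique_size (cl a))%N.
    by apply/card_gt1P; exists a, b; rewrite !inE cab.
  have off c d : cl c = cl a -> cl d = cl a -> c != d -> X c d = 0.
    have Xad e : cl e = cl a -> a != e -> X a e = 0.
      move=> ce ae; apply: (spread a e b ae nab _ Xab); by rewrite ce.
    move=> cc cd ncd; have [eac|nac] := eqVneq a c; first by rewrite -eac Xad // eac.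
    have [ead|nad] := eqVneq a d; first by rewrite XT -ead Xad // ead eq_sym.
    by rewrite XT; apply: (spread d c a) => //; rewrite 1?eq_sym // XT Xad.
  have diag c : cl c = cl a -> X c c = X a a.
    move=> cc; have [->//|nca] := eqVneq c a.
    have Xca : X c a = 0 by apply: off.
    have HXE d : (reflection c a 2 *m X) c d =
        reflection c a 2 c c * X c d + reflection c a 2 c a * X a d.
      rewrite mulmxE (bigD1 c) //= (bigD1 a) 1?eq_sym //= big1 ?addr0 // => e /andP[ec ea].
      by rewrite -[reflection _ _ _]reflection_sym mxE Hrow // (negbTE ec) mul0r.
    have := stab c a c a nca cc Xca; rewrite mulmxE (bigD1 c) //= (bigD1 a) 1?eq_sym //=.
    rewrite big1 ?addr0 => [|e /andP[ec ea]]; last by rewrite Hrow // (negbTE ea) mulr0.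
    rewrite !HXE (XT a c) Xca !mulr0 addr0 add0r !reflectionE !eqxx (eq_sym a) (negbTE nca) /=.
    rewrite !(mulr0n, mulr1n, mulr0, mulr1, addr0, add0r, sub0r).
    (* The reflection has diagonal entries [-3/5] at [c], [3/5] at [a] and off-diagonal entry
       [-4/5], so [E] reads [12/25 (X c c - X a a) = 0]. Parameter 1 would give zero diagonal
       entries and no information. *)
    move=> E; apply/eqP; rewrite -subr_eq0; apply/eqP.
    have -> : X c c - X a a = (25 / 12) * 0 by rewrite -E; field.
    by rewrite mulr0.
  have /eqP[] := Xns (cl a) (X a a) sz; apply/matrixP => c d; rewrite blockE !mxE.
  have [<-|ncd] := eqVneq c d.
    by have [cc|] := eqVneq (cl c) (cl a); rewrite /= ?mulr0n ?mulr1n ?mulr1 ?mulr0 ?diag.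
  by rewrite mulr0n mulr0; case: ifP => // /andP[/eqP cc /eqP cd]; apply: off.
have nclE c d : cl c = cl a -> cl d = cl b -> c != d.
  by move=> cc cd; apply: contraNneq ncab => ecd; rewrite -cc -cd ecd.
have row0 d : cl d = cl b -> X a d = 0.
  by move=> cd; apply: (spread a d b) => //; apply: nclE.
have /eqP[] := Xn0 _ _ nsd; apply/matrixP => c d; rewrite blockE mxE.
case: ifP => // /andP[/eqP cc /eqP cd].
have ndc : d != c by rewrite eq_sym nclE.
have nda : d != a by rewrite eq_sym nclE.
by rewrite XT (spread d c a ndc nda cc) // XT row0.
Qed.

(** [Phi] stands for the polynomial identity to be kept. While some reflection of parameter 2 makes
    a zero entry nonzero, [reflection_gains] yields a conjugate with more nonzero entries, possibly
    at another parameter. Their number is at most [N * N], so the process ends with stable zeros. *)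
Lemma exists_join_pattern (Phi : 'M[R]_N -> Prop) X :
  (forall Y H, Phi Y -> H^T = H -> H *m H = 1%:M -> Phi (H *m Y *m H)) ->
  X^T = X -> Phi X -> block_pattern X ->
  exists Y, [/\ Y^T = Y, Phi Y & join_pattern Y].
Proof.
move=> PhiH; have [d] := ubnP (N * N - num_nonzero X)%N.
elim: d X => // d IHd X leXd symX PhiX bpX.
case E : [exists p, exists q, exists a, exists b, [&& p != q, cl p == cl q, X a b == 0 &
    (reflection p q 2 *m X *m reflection p q 2) a b != 0]]; last first.
  exists X; split=> //; apply: stable_zeros_join_pattern => // p q a b npq cpq Xab.
  apply/eqP; apply: contraFT E => H0; apply/existsP; exists p; apply/existsP; exists q.
  by apply/existsP; exists a; apply/existsP; exists b; rewrite npq cpq Xab !eqxx.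
move/existsP: E => [p /existsP[q /existsP[a /existsP[b /and4P[npq /eqP cpq /eqP Xab Hab]]]]].
have [t gain] := reflection_gains Xab Hab.
have HK := reflectionK t npq; have HT := reflection_sym p q t.
apply: (IHd (reflection p q t *m X *m reflection p q t)).
- have := max_card [pred u : 'I_N * 'I_N |
      (reflection p q t *m X *m reflection p q t) u.1 u.2 != 0].
  rewrite card_prod card_ord -/(num_nonzero _) => le.
  rewrite -ltnS; apply: leq_trans leXd; rewrite ltnS ltn_sub2l //.
  exact: leq_trans gain le.
- by rewrite !trmx_mul symX HT mulmxA.
- exact: PhiH.
- by apply: block_pattern_conj => // i; apply: reflection_proj.
Qed.

End Blocks.

(** * Necessary conditions *)

Lemma mulmx_tr_neq0 (R : realDomainType) n (w : 'rV[R]_n) :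
  w != 0 -> w *m w^T != 0.
Proof.
apply: contraNneq => /matrixP/(_ 0 0); rewrite !mxE => ww0; apply/eqP/rowP => a.
apply/eqP; rewrite mxE -sqrf_eq0 expr2; apply/eqP.
by have := psumr_eq0P _ ww0 (i := a); rewrite mxE; apply=> // b _; rewrite mxE -expr2 sqr_ge0.
Qed.

(** The Gram matrix of the family is diagonal with nonzero entries, hence invertible. *)
Lemma orthogonal_family_rank (R : realFieldType) (J : finType) m n
    (f : J -> 'rV[R]_n) (U : 'M_(m, n)) :
  (forall j, f j != 0) -> (forall j j', j != j' -> f j *m (f j')^T = 0) ->
  (forall j, (f j <= U)%MS) -> (#|J| <= \rank U)%N.
Proof.
move=> f0 fo fU; pose F := \matrix_(t < #|J|) f (enum_val t).
have FF : F *m F^T = diag_mx (\row_t (f (enum_val t) *m (f (enum_val t))^T) 0 0).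
  apply/matrixP => t t'; rewrite [RHS]mxE.
  have -> : (F *m F^T) t t' = (f (enum_val t) *m (f (enum_val t'))^T) 0 0.
    by rewrite !mxE; apply: eq_bigr => a _; rewrite !mxE.
  have [<-|ntt] := eqVneq t t'; first by rewrite mulr1n [RHS]mxE.
  by rewrite fo ?mxE ?mulr0n // (inj_eq enum_val_inj).
apply: (@leq_trans (\rank F)); last first.
  by apply/mxrankS/row_subP => t; rewrite rowK.
apply: leq_trans (mxrankM_maxl F F^T); rewrite mxrank_unit // FF unitmxE det_diag unitfE.
apply/prodf_neq0 => t _; rewrite mxE.
apply: contraNneq (mulmx_tr_neq0 (f0 (enum_val t))) => e0.
by apply/eqP/matrixP => a b; rewrite !ord1 e0 mxE.
Qed.

Section Necessity.
Context {R : rcfType} {N : nat} {I : finType}.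
Context (cl : 'I_N -> I) (side : I -> bool).
Context (X : 'M[R]_N).
Local Notation P := (@clique_proj R N I cl).
Local Notation sz := (clique_size cl).

Lemma clique_proj_sym i : (P i)^T = P i.
Proof. exact: tr_diag_mx. Qed.

Lemma clique_projM i j : P i *m P j = if i == j then P i else 0.
Proof.
rewrite /clique_proj mulmx_diag; case: eqP => [<-|nij]; apply/matrixP => a b; rewrite !mxE.
  by case: eqP; rewrite ?mulr1 ?mul0r.
have [->|_] := eqVneq (cl a) i; last by rewrite mul0r mul0rn.
by move/eqP/negbTE: nij => ->; rewrite mulr0 mul0rn.
Qed.

Lemma sum_clique_proj : \sum_i P i = 1%:M.
Proof.
apply/matrixP => a b; rewrite summxE mxE (bigD1 (cl a)) //= big1 => [|i nia].
  by rewrite !mxE eqxx addr0.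
by rewrite !mxE eq_sym (negbTE nia) mul0rn.
Qed.

Lemma rank_clique_proj i : (\rank (P i) <= sz i)%N.
Proof.
rewrite /clique_size -sum1_card.
have -> : P i = \sum_(a | cl a == i) delta_mx a a.
  apply/matrixP => a b; rewrite summxE !mxE.
  have [<-|ncl] := eqVneq (cl a) i; last first.
    rewrite mul0rn big1 // => c /eqP cc; rewrite mxE; case: eqP => //= eac.
    by rewrite eac cc eqxx in ncl.
  rewrite (bigD1 a) //= mxE eqxx big1 ?addr0 1?eq_sym // => c /andP[_ nca].
  by rewrite mxE eq_sym (negbTE nca).
elim/big_rec2: _ => [|a r B _ le]; first by rewrite mxrank0.
by apply: leq_trans (mxrank_add _ _) _; rewrite mxrank_delta leq_add2l.
Qed.

Definition side_proj s : 'M[R]_N := \sum_(i | side i == s) P i.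

Lemma side_projN s : side_proj (~~ s) = \sum_(i | side i != s) P i.
Proof. by apply: eq_bigl => i; case: (side i) s => [] []. Qed.

Lemma side_projD s : side_proj s + side_proj (~~ s) = 1%:M.
Proof.
rewrite -sum_clique_proj (bigID (fun i => side i == s)) /=; congr (_ + _).
exact: side_projN.
Qed.

Lemma clique_side_proj i s : P i *m side_proj s = if side i == s then P i else 0.
Proof.
rewrite /side_proj mulmx_sumr; case: ifP => si.
  rewrite (bigD1 i) //= clique_projM eqxx big1 ?addr0 // => j /andP[_ nji].
  by rewrite clique_projM eq_sym (negbTE nji).
rewrite big1 // => j /eqP sj; rewrite clique_projM; case: eqP => // eij.
by rewrite eij sj eqxx in si.
Qed.

Lemma side_proj_sym s : (side_proj s)^T = side_proj s.
Proof. by rewrite /side_proj linear_sum /=; apply: eq_bigr => i _; rewrite clique_proj_sym. Qed.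

Lemma side_projM s : side_proj s *m side_proj s = side_proj s.
Proof.
rewrite {1}/side_proj mulmx_suml; apply: eq_bigr => i si.
by rewrite clique_side_proj si.
Qed.

(* Eigenvectors of the diagonal block of [X] at [i], extended by zero. *)
Definition local_eigen i (lam : R) (w : 'rV[R]_N) : Prop :=
  w *m P i = w /\ w *m X *m P i = lam *: w.

Context (symX : X^T = X) (XX : X *m X = 1%:M).
Context (bpX : block_pattern cl side X).

Lemma block_side i : P i *m X *m side_proj (side i) = P i *m X *m P i.
Proof.
rewrite /side_proj mulmx_sumr (bigD1 i) //= big1 ?addr0 // => j /andP[/eqP sj nji].
by rewrite (block_eq0 bpX) // eq_sym.
Qed.

Lemma side_block i : side_proj (side i) *m X *m P i = P i *m X *m P i.
Proof.
apply: trmx_inj; rewrite !trmx_mul symX !clique_proj_sym side_proj_sym !mulmxA.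
exact: block_side.
Qed.

Lemma local_eigen_side i lam w : local_eigen i lam w ->
  w *m X *m side_proj (side i) = lam *: w.
Proof.
case=> wP wX; rewrite -{1}wP -!mulmxA mulmxA -mulmxA (mulmxA (P i)) block_side.
by rewrite !mulmxA wP.
Qed.

(** The vector [w X X = w] has no part in clique [j]. The part [lam *: w] of [w X] on the side of
    [i] contributes [lam] times the transfer, which the part on the side of [j] must cancel. *)
Lemma local_eigen_transfer i j lam w : local_eigen i lam w -> side j = ~~ side i ->
  local_eigen j (- lam) (w *m X *m P j).
Proof.
move=> wi sj; have [wP wX] := wi; split; first by rewrite -mulmxA clique_projM eqxx.
(* Within the side of [j] the matrix [X] is block diagonal, so the inner [P j] may be widened to the
   projection on that whole side. *)
have -> : w *m X *m P j *m X *m P j = w *m X *m (1%:M - side_proj (side i)) *m X *m P j.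
  have -> : 1%:M - side_proj (side i) = side_proj (side j).
    by rewrite sj -(side_projD (side i)) addrC addKr.
  by rewrite -!mulmxA (mulmxA (P j)) (mulmxA (side_proj _)) side_block.
rewrite mulmxBr mulmx1 mulmxBl (local_eigen_side wi) -(mulmxA w X X) XX mulmx1.
rewrite mulmxBl -{1}wP -(mulmxA w (P i)) clique_projM.
have -> : i == j = false by apply/eqP => eij; move: sj; rewrite eij; case: (side j).
by rewrite mulmx0 sub0r -!scalemxAl scaleNr.
Qed.

(** As [X] is a symmetric involution, [w X] and [u X] have inner product [w u^T]; their parts on
    side [s] are [lam *: w] and [mu *: u], and account for [lam * mu] times it. *)
Lemma cross_dot i j s lam mu w u :
  local_eigen i lam w -> local_eigen j mu u -> side i = s -> side j = s ->
  (w *m X *m side_proj (~~ s)) *m (u *m X *m side_proj (~~ s))^T =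
  (1 - lam * mu) *: (w *m u^T).
Proof.
move=> wi uj si sj; rewrite !trmx_mul side_proj_sym symX !mulmxA.
rewrite -(mulmxA (w *m X)) side_projM.
have -> : side_proj (~~ s) = 1%:M - side_proj s *m side_proj s.
  by rewrite side_projM -(side_projD s) addrC addKr.
rewrite mulmxBr mulmx1 mulmxA -si (local_eigen_side wi) si !mulmxBl -(mulmxA w X X) XX mulmx1.
rewrite -!scalemxAl -!mulmxA.
have -> : side_proj s *m (X *m u^T) = mu *: u^T.
  apply: trmx_inj; rewrite !trmx_mul side_proj_sym symX trmxK linearZ /= trmxK -sj.
  exact: local_eigen_side uj.
by rewrite -scalemxAr scalerA scalerBl scale1r.
Qed.

Lemma side_clique_proj i s : side i = s -> side_proj s *m P i = P i.
Proof.
move=> si; apply: trmx_inj; rewrite trmx_mul side_proj_sym clique_proj_sym.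
by rewrite clique_side_proj si eqxx.
Qed.

Lemma cross_neq0 i s lam w : local_eigen i lam w -> side i = s -> lam * lam != 1 ->
  w != 0 -> w *m X *m side_proj (~~ s) != 0.
Proof.
move=> wi si lam1 w0; have := cross_dot wi wi si si; apply: contra_eqN => /eqP->.
by rewrite mul0mx eq_sym scaler_eq0 subr_eq0 eq_sym (negbTE lam1) (negbTE (mulmx_tr_neq0 w0)).
Qed.

(** By [cross_dot] the squared length of the transfer is [1 - lam * lam] times that of [w], so the
    inequation says that [lam] lies strictly between -1 and 1. *)
Definition interior_eigen i lam w :=
  [/\ local_eigen i lam w, lam * lam != 1 & w != 0].

(** The block between [i] and [j] is nonzero, hence some eigenvector of the diagonal block at [i]
    has a nonzero transfer to [j]. Its eigenvalue is interior, as otherwise [cross_dot] would make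
    the transfer vanish. *)
Lemma shared_eigenvalue i j : side j = ~~ side i ->
  exists lam w u, interior_eigen i lam w /\ interior_eigen j (- lam) u.
Proof.
move=> sj; have sij : side i != side j by rewrite sj; case: (side i).
have symA : (P i *m X *m P i)^T = P i *m X *m P i.
  by rewrite !trmx_mul symX !clique_proj_sym mulmxA.
have [lam [v [vA vB]]] := symmetric_eigenvectors_separate symA (block_neq0 bpX sij).
(* When [lam] is 0, [v] may have entries outside clique [i]; the projection removes them without
   changing the transfer to [j]. *)
pose w := v *m P i.
have wi : local_eigen i lam w.
  rewrite /local_eigen /w -mulmxA clique_projM eqxx; split=> //.
  by rewrite scalemxAl -vA -!mulmxA clique_projM eqxx.
have wB : w *m X *m P j != 0 by move: vB; rewrite /w !mulmxA.
have w0 : w != 0 by apply: contraNneq wB => ->; rewrite !mul0mx.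
have lam1 : lam * lam != 1.
  apply: contraNneq wB => lam1; have := cross_dot wi wi erefl erefl.
  rewrite lam1 subrr scale0r => y0.
  have {y0}/eqP : w *m X *m side_proj (~~ side i) == 0.
    by apply: contraT => /mulmx_tr_neq0; rewrite y0 eqxx.
  by rewrite -[P j](side_clique_proj sj) mulmxA => ->; rewrite mul0mx.
exists lam, w, (w *m X *m P j); split; split=> //; last by rewrite mulrNN.
exact: local_eigen_transfer wi sj. 
Qed.

Lemma local_eigen_ortho i j lam mu w u : local_eigen i lam w -> local_eigen j mu u ->
  (i != j) || (lam != mu) -> w *m u^T = 0.
Proof.
move=> [wP wX] [uP uX]; have [eij /= nlm|nij _] := eqVneq i j; last first.
  rewrite -wP -uP trmx_mul clique_proj_sym mulmxA -(mulmxA w) clique_projM.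
  by rewrite (negbTE nij) mulmx0 mul0mx.
subst j; have e1 : w *m X *m u^T = lam *: (w *m u^T).
  by rewrite -{1}uP trmx_mul clique_proj_sym mulmxA wX scalemxAl.
have e2 : w *m X *m u^T = mu *: (w *m u^T).
  apply: trmx_inj; rewrite linearZ /= !trmx_mul !trmxK symX mulmxA.
  by rewrite -{1}wP trmx_mul clique_proj_sym mulmxA uX scalemxAl.
apply/eqP; have /eqP := e1; rewrite e2 eq_sym -subr_eq0 -scalerBl scaler_eq0 subr_eq0.
by rewrite (negbTE nlm).
Qed.

Section Family.
Context (J : finType) (idx : J -> I) (ev : J -> R) (vec : J -> 'rV[R]_N) (s : bool).
Context (sidx : forall t, side (idx t) = s).
Context (inter : forall t, interior_eigen (idx t) (ev t) (vec t)).
Context (sep : forall t t', t != t' -> (idx t != idx t') || (ev t != ev t')).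

Let cross t := vec t *m X *m side_proj (~~ s).

Let cross0 t : cross t != 0.
Proof. by have [wi lam1 w0] := inter t; apply: cross_neq0 wi _ lam1 w0. Qed.

Let cross_ortho t t' : t != t' -> cross t *m (cross t')^T = 0.
Proof.
move=> ntt; have [wi _ _] := inter t; have [wi' _ _] := inter t'.
by rewrite (cross_dot wi wi') // (local_eigen_ortho wi wi') ?sep // scaler0.
Qed.

(** The transfers are nonzero and pairwise orthogonal in the coordinate space of the opposite
    side. *)
Lemma interior_family_card : (#|J| <= \sum_(i | side i != s) sz i)%N.
Proof.
apply: leq_trans (orthogonal_family_rank (U := side_proj (~~ s)) cross0 cross_ortho _) _.
  by move=> t; rewrite submxMl.
rewrite side_projN; elim/big_rec2: _ => [|i r B _ le]; first by rewrite mxrank0.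
by apply: leq_trans (mxrank_add _ _) _; rewrite leq_add ?rank_clique_proj.
Qed.

(** All transfers lie in the [- lam] eigenspaces of the opposite diagonal blocks. In a clique of
    size at least 2 the block is not scalar, so the eigenspace is proper and one dimension is
    saved. *)
Lemma interior_family_card_constant lam : (forall t, ev t = lam) ->
  (#|J| <= \sum_(i | side i != s) (sz i - (1 < sz i)))%N.
Proof.
move=> evE; pose U i := (P i :&: eigenspace (X *m P i) (- lam))%MS.
apply: leq_trans (orthogonal_family_rank (U := (\sum_(i | side i != s) U i)%MS)
  cross0 cross_ortho _) _.
  move=> t; rewrite /cross side_projN mulmx_sumr.
  apply: summx_sub_sums => i si; rewrite sub_capmx submxMl /=.
  have [wi _ _] := inter t.
  have [|uP uX] := local_eigen_transfer (j := i) wi.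
    by rewrite sidx; case: (side i) s si => [] [].
  by apply/eigenspaceP; rewrite mulmxA uX evE.
apply: leq_trans (_ : \sum_(i | side i != s) \rank (U i) <= _)%N.
  elim/big_rec2: _ => [|i r B _ le]; first by rewrite mxrank0.
  by apply: leq_trans (mxrank_adds_leqif _ _) _; rewrite leq_add2l.
apply: leq_sum => i _; have leU : (\rank (U i) <= \rank (P i))%N by rewrite mxrankS // capmxSl.
have := rank_clique_proj i; case: (ltnP 1 (sz i)) => [sz1 le|_ le]; last first.
  by rewrite subn0 (leq_trans leU).
rewrite subn1 -ltnS prednK; last by rewrite (leq_trans _ sz1).
apply: leq_trans le; rewrite ltn_neqAle leU andbT.
apply: contraNneq (block_nonscalar bpX (- lam) sz1) => eqr.
have : (P i <= eigenspace (X *m P i) (- lam))%MS.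
  apply: submx_trans (capmxSr (P i) _).
  by rewrite -(geq_leqif (mxrank_leqif_sup (capmxSl _ _))) eqr.
by move/eigenspaceP; rewrite mulmxA => ->.
Qed.

End Family.

Lemma singleton_local_eigen i lam mu w u : sz i = 1%N ->
  local_eigen i lam w -> w != 0 -> local_eigen i mu u -> u != 0 -> lam = mu.
Proof.
rewrite /clique_size => /mem_card1[a aE].
suff ev v nu : local_eigen i nu v -> v != 0 -> nu = X a a.
  by move=> wi w0 ui u0; rewrite (ev _ _ wi w0) (ev _ _ ui u0).
move=> [vP vX] v0; have vE b : v 0 b = (b == a)%:R * v 0 a.
  have clE c : (cl c == i) = (c == a) by have := aE c; rewrite !inE.
  rewrite -vP /clique_proj mul_mx_diag !mxE clE; case: eqVneq => [->|]; last by rewrite mulr0 mul0r.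
  by rewrite clE eqxx mulr1 mul1r.
have va : v 0 a != 0.
  by apply: contraNneq v0 => va; apply/eqP/rowP => b; rewrite vE va mulr0 mxE.
apply: (mulIf va); have /rowP/(_ a) := vX; rewrite [RHS]mxE => <-.
have clE : cl a == i by have := aE a; rewrite !inE eqxx.
rewrite /clique_proj mul_mx_diag mxE [X in _ * X]mxE clE mulr1 mxE (bigD1 a) //= big1 ?addr0.
  exact: mulrC.
by move=> b nba; rewrite vE (negbTE nba) !mul0r.
Qed.

Lemma involution_necessity s :
  (exists i, side i == s) -> (exists i, side i != s) ->
  [/\ (#|[pred i | side i != s]| <= \sum_(i | side i == s) sz i)%N,
      (exists2 i, side i == s & sz i = 1%N) ->
        (#|[pred i | side i != s]| <= \sum_(i | side i == s) (sz i - (1 < sz i)))%N &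
      (#|[pred i | side i != s]| <= \sum_(i | side i == s) (sz i - (1 < sz i)))%N \/
      (2 * #|[pred i | side i == s]| <= \sum_(i | side i != s) sz i)%N].
Proof.
have otherP i : side i != s -> side i = ~~ s by case: (side i) (s) => [] [].
have sideN i : (side i != ~~ s) = (side i == s) by case: (side i) (s) => [] [].
move=> [i0 si0] [j0 sj0].
pose J := {j | side j != s}; have cJ : #|{: J}| = #|[pred i | side i != s]| by rewrite card_sig.
have sJ (j : J) : side (val j) = ~~ s by apply: otherP; exact: (valP j).
(* Clique [i] shares an interior eigenvalue, up to sign, with every clique of the other side; if it
   has only one, those cliques all have the same [- lam]. *)
have unique_bound i : side i == s ->
    (forall lam w mu u, interior_eigen i lam w -> interior_eigen i mu u -> lam = mu) ->
    (#|[pred i | side i != s]| <= \sum_(i | side i == s) (sz i - (1 < sz i)))%N.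
  move=> /eqP si uniq.
  have [|lam [w [_ [wi _]]]] := @shared_eigenvalue i j0.
    by rewrite si; apply: otherP.
  have /fin_all_exists[u ju] : forall j : J, exists u, interior_eigen (val j) (- lam) u.
    move=> j; have [|mu [w' [u [wi' uj]]]] := @shared_eigenvalue i (val j).
      by rewrite sJ si.
    by exists u; rewrite (uniq _ _ _ _ wi wi').
  rewrite -cJ; under eq_bigl do rewrite -sideN.
  apply: (@interior_family_card_constant J val (fun=> - lam) u (~~ s)) => //.
  by move=> t t' ntt; rewrite (inj_eq val_inj) ntt.
split.
(* One interior eigenvector is taken for each clique off side [s]; the transfers live on side
   [s]. *)
- have /fin_all_exists[lam /fin_all_exists[u ju]] : forall j : J, exists lam u,
      interior_eigen (val j) lam u.
    move=> j; have [|lam [u [_ [uj _]]]] := @shared_eigenvalue (val j) i0; last by exists lam, u.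
    by rewrite sJ negbK (eqP si0).
  rewrite -cJ; under eq_bigl do rewrite -sideN.
  apply: (@interior_family_card J val lam u (~~ s)) => //.
  by move=> t t' ntt; rewrite (inj_eq val_inj) ntt.
- move=> [i si szi]; apply: (unique_bound i si) => lam w mu u [wi _ w0] [ui _ u0].
  exact: singleton_local_eigen szi wi w0 ui u0.
- have [[i si uniq]|nuniq] := EM (exists2 i, side i == s &
    forall lam w mu u, interior_eigen i lam w -> interior_eigen i mu u -> lam = mu).
    by left; apply: unique_bound uniq.
  (* Now every clique of side [s] carries two distinct interior eigenvalues, whence a family indexed
     by [K * bool]. *)
  right; pose K := {i | side i == s}.
  have /fin_all_exists[lam /fin_all_exists[w /fin_all_exists[mu /fin_all_exists[u H]]]] :
      forall k : K, exists lam w mu u, [/\ interior_eigen (val k) lam w,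
        interior_eigen (val k) mu u & lam != mu].
    move=> [i si] /=; apply: contrapT => H; apply: nuniq; exists i => // lam w mu u wi ui.
    by apply/eqP; apply: contrapT => /negP nlm; apply: H; exists lam, w, mu, u.
  have -> : (2 * #|[pred i | side i == s]|)%N = #|{: K * bool}|.
    by rewrite card_prod card_bool card_sig mulnC.
  apply: (@interior_family_card _ (fun t => val t.1)
    (fun t => if t.2 then lam t.1 else mu t.1) (fun t => if t.2 then w t.1 else u t.1) s).
  + by move=> [[k sk] b] /=; apply/eqP.
  + by move=> [k []] /=; have [] := H k.
  + move=> [k b] [k' b'] /=; rewrite xpair_eqE negb_and (inj_eq val_inj).
    have [<-|//] := eqVneq k k'; have [_ _ nlm] := H k.
    by case: b b' => [] [] //= _; rewrite eq_sym.
Qed.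

End Necessity.

(** * Constructions *)

(* On each colour class, a Householder reflection; giving one representative of
   the class the coordinate [L] keeps the diagonal entries nonzero. *)
Lemma coloured_involution (R : realFieldType) (C : eqType) L (col : 'I_L -> C) :
  exists Q : 'M[R]_L, [/\ Q^T = Q, Q *m Q = 1%:M &
    forall t t', (Q t t' != 0) = (col t == col t')].
Proof.
pose rep t := odflt t [pick s | col s == col t].
have col_rep t : col (rep t) = col t.
  by rewrite /rep; case: pickP => //= s /eqP.
have rep_eq t t' : col t = col t' -> rep t = rep t'.
  move=> ctt; rewrite /rep (eq_pick (Q := fun s => col s == col t')) => [|s]; last by rewrite ctt.
  by case: pickP => //= /(_ t); rewrite ctt eqxx.
pose u t : nat := if rep t == t then L else 1%N.
pose S t : nat := (\sum_(s | col s == col t) u s ^ 2)%N.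
have L0 (t : 'I_L) : (0 < L)%N by apply: leq_trans (ltn_ord t).
have u0 t : (0 < u t)%N by rewrite /u; case: ifP => // _; exact: L0 t.
have S_eq t t' : col t = col t' -> S t = S t'.
  by move=> ctt; apply: eq_bigl => s; rewrite ctt.
have S0 t : (0 < S t)%N.
  by rewrite /S (bigD1 t) //= ltn_addr // expn_gt0 u0.
(* The diagonal entry of the reflection at [t] is [1 - 2 (u t)^2 / S t]. At a representative the
   other coordinates contribute less than [L ^ 2]; elsewhere [S t] is at least [L ^ 2 + 1], more
   than 2. *)
have Su t : S t != (2 * u t ^ 2)%N.
  have [rt|nrt] := eqVneq (rep t) t.
    rewrite ltn_eqF // /S (bigD1 t) //= mul2n -addnn ltn_add2l.
    have -> : u t = L by rewrite /u rt eqxx.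
    rewrite (eq_bigr (fun=> 1%N)) => [|s /andP[/eqP cst nst]]; last first.
      by rewrite /u (rep_eq _ _ cst) rt eq_sym (negbTE nst).
    rewrite sum1_card; apply: (@leq_trans L).
      rewrite -[X in (_ < X)%N]card_ord; apply: proper_card; apply/properP.
      split; first exact/subset_predT.
      by exists t; rewrite ?unfold_in ?eqxx ?andbF.
    by rewrite leq_pmulr // (L0 t).
  rewrite gtn_eqF // /S (bigD1 t) //= (bigD1 (rep t)) /=; last by rewrite col_rep eqxx.
  have -> : u (rep t) = L by rewrite /u (rep_eq _ t (col_rep t)) eqxx.
  have -> : u t = 1%N by rewrite /u (negbTE nrt).
  have L2 : (1 < L)%N.
    by have := ltn_ord t; have := ltn_ord (rep t); move: nrt; rewrite -val_eqE /=; lia.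
  by rewrite addnA; apply: ltn_addr; nia.
pose M : 'M[R]_L := \matrix_(t, t') (if col t == col t' then (u t * u t')%:R / (S t)%:R else 0).
have S0R t : (S t)%:R != 0 :> R by rewrite pnatr_eq0 -lt0n.
have MT : M^T = M.
  by apply/matrixP => t t'; rewrite !mxE eq_sym; case: eqP => // /S_eq->; rewrite mulnC.
have MM : M *m M = M.
  apply/matrixP => t t'; rewrite !mxE; under eq_bigr do rewrite !mxE.
  rewrite (bigID (fun s => col s == col t)) /= [X in _ + X]big1 => [|s /negbTE ns]; last first.
    by rewrite eq_sym ns mul0r.
  rewrite addr0; under eq_bigr => s /eqP cs do rewrite cs eqxx (S_eq _ _ cs).
  case: ifP => _; last by rewrite big1 // => s _; rewrite mulr0.
  rewrite (eq_bigr (fun s => (u s ^ 2)%:R * ((u t * u t')%:R / (S t)%:R / (S t)%:R))) => [|s _].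
    by rewrite -mulr_suml -natr_sum -/(S t); field.
  by rewrite !natrM; field.
exists (1%:M - 2 *: M); split.
- by rewrite linearB linearZ /= trmx1 MT.
- rewrite mulmxBl mul1mx mulmxBr mulmx1 -scalemxAl -scalemxAr MM scalerA.
  by apply/matrixP => t t'; rewrite !mxE; ring.
- move=> t t'; rewrite !mxE; have [<-|ntt] := eqVneq t t'.
    rewrite !eqxx mulr1n subr_eq0 ?mxE ?eqxx mulrA -natrM; apply/eqP => /(congr1 ( *%R^~ (S t)%:R)).
    rewrite mul1r divfK // => /eqP; rewrite eqr_nat => E.
    by have := Su t; rewrite (eqP E) -mulnn eqxx.
  rewrite mulr0n sub0r oppr_eq0 ?mxE; case: ifP => _; last by rewrite mulr0 eqxx.
  by rewrite !mulf_neq0 ?invr_eq0 ?S0R ?pnatr_eq0 ?muln_eq0 ?negb_or -?lt0n ?u0.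
Qed.

Section Embed.
Context {R : realFieldType} {N M : nat} (e : 'I_M -> 'I_N) (e_inj : injective e).
Context (Y : 'M[R]_M).

Let V : 'M[R]_(M, N) := \matrix_(s, a) (a == e s)%:R.

Let VV : V *m V^T = 1%:M.
Proof.
apply/matrixP => s s'; rewrite !mxE (bigD1 (e s)) //= big1 => [|a nas].
  by rewrite !mxE eqxx mul1r addr0 (inj_eq e_inj).
by rewrite mxE (negbTE nas) mul0r.
Qed.

(** [V^T *m V] is the projection on the coordinates in the image of [e]: the matrix acts as [Y]
    there and as the identity on the others. *)
Definition embed : 'M[R]_N := V^T *m Y *m V + (1%:M - V^T *m V).

Lemma embed_sym : Y^T = Y -> embed^T = embed.
Proof. by move=> YT; rewrite /embed !linearD linearN /= !trmx_mul trmxK trmx1 YT mulmxA. Qed.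

Lemma embedK : Y *m Y = 1%:M -> embed *m embed = 1%:M.
Proof.
move=> YY; rewrite /embed; set A := _ *m Y *m V; set E := V^T *m V.
have AA : A *m A = E.
  by rewrite /A -!mulmxA (mulmxA V) VV mul1mx (mulmxA Y) YY mul1mx.
have AE : A *m E = A by rewrite /A /E -!mulmxA (mulmxA V) VV mul1mx.
have EA : E *m A = A by rewrite /A /E -!mulmxA (mulmxA V) VV mul1mx.
have EE : E *m E = E by rewrite /E -!mulmxA (mulmxA V) VV mul1mx.
rewrite !(mulmxDl, mulmxDr, mulmxN, mulNmx, mulmx1, mul1mx) AA AE EA EE opprK.
by apply/matrixP => a b; rewrite !mxE; ring.
Qed.

Lemma embed_in s s' : embed (e s) (e s') = Y s s'.
Proof.
have Ve : V *m delta_mx (e s') 0 = delta_mx s' (0 : 'I_1).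
  by rewrite -colE; apply/colP => r; rewrite !mxE eqxx andbT (inj_eq e_inj) eq_sym.
have -> : embed (e s) (e s') =
    (delta_mx (0 : 'I_1) (e s) *m embed *m delta_mx (e s') (0 : 'I_1)) 0 0.
  by rewrite -rowE -colE !mxE.
have VeT : delta_mx (0 : 'I_1) (e s) *m V^T = delta_mx (0 : 'I_1) s.
  by rewrite -rowE; apply/rowP => r; rewrite !mxE eqxx /= (inj_eq e_inj) eq_sym.
rewrite /embed mulmxDr mulmxDl mulmxBr mulmxBl !mulmxA mulmx1 VeT -!mulmxA Ve.
rewrite !mul_delta_mx_cond (inj_eq e_inj) subrr addr0.
by rewrite mulmxA -rowE -colE !mxE.
Qed.

Lemma embed_out a b : (forall s, a != e s) -> embed a b = (a == b)%:R.
Proof.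
move=> na; rewrite /embed -mulmxA !mxE [X in _ + (_ - X)]big1 => [|s _]; last first.
  by rewrite !mxE (negbTE (na s)) mul0r.
rewrite big1 => [|s _]; last by rewrite [X in X * _]mxE [X in X * _]mxE (negbTE (na s)) mul0r.
by rewrite subr0 add0r.
Qed.

End Embed.

Section TwoEigenvalues.
Context {R : realFieldType} {N : nat} {I : finType} {L : nat}.
Context (cl : 'I_N -> I) (side : I -> bool) (f g : 'I_L -> 'I_N) (col : 'I_L -> bool).
Context (delta c : R).

(** Makes the diagonal of the block at [i] take two values: plus or minus [delta] at a slot and 1 at
    a vertex outside the slots, or [delta] and [- delta] at slots of both colours. *)
Definition mixed (h : 'I_L -> 'I_N) i : Prop :=
  (exists t, cl (h t) = i) /\
  ((exists2 a, cl a = i & forall t, a != h t) \/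
   delta != 0 /\ exists t t', [/\ cl (h t) = i, cl (h t') = i & col t != col t']).

(* In the coordinates given by the slots [f] and [g], [X] is
   [[D, c Q], [c Q, - D]] with [D] diagonal of entries [delta] and [- delta]
   according to the colours; it is the identity on the other vertices. *)
Lemma slots_involution :
  delta ^+ 2 + c ^+ 2 = 1 -> c != 0 -> injective f -> injective g ->
  (forall t, side (cl (f t))) -> (forall t, ~~ side (cl (g t))) ->
  (forall i j, side i -> ~~ side j ->
    exists t t', [/\ cl (f t) = i, cl (g t') = j & col t = col t']) ->
  (forall i, side i -> (1 < clique_size cl i)%N -> mixed f i) ->
  (forall i, ~~ side i -> (1 < clique_size cl i)%N -> mixed g i) ->
  exists X : 'M[R]_N, [/\ X^T = X, X *m X = 1%:M & block_pattern cl side X].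
Proof.
move=> dc c0 f_inj g_inj fs gs share mixf mixg.
have [Q [QT QQ Qcol]] := coloured_involution R col.
pose dl t := if col t then delta else - delta.
have dl2 t : dl t * dl t = delta ^+ 2 by rewrite /dl; case: ifP => _; rewrite ?mulrNN.
pose D : 'M[R]_L := diag_mx (\row_t dl t).
have DT : D^T = D by exact: tr_diag_mx.
have DD : D *m D = (delta ^+ 2)%:M.
  by rewrite /D mulmx_diag; apply/matrixP => t t'; rewrite !mxE dl2.
(* [Q] only links slots of equal colour, on which [D] is constant; commutation cancels the
   off-diagonal blocks of [Y *m Y]. *)
have DQ : D *m Q = Q *m D.
  apply/matrixP => t t'; rewrite /D mul_diag_mx mul_mx_diag !mxE.
  have [ctt|nctt] := eqVneq (col t) (col t'); first by rewrite /dl ctt mulrC.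
  have /eqP-> : Q t t' == 0 by rewrite -[_ == _]negbK Qcol.
  by rewrite mulr0 mul0r.
pose Y := block_mx D (c *: Q) (c *: Q) (- D).
have YT : Y^T = Y by rewrite /Y tr_block_mx linearN !linearZ /= DT QT.
have YY : Y *m Y = 1%:M.
  rewrite /Y mulmx_block -!scalemxAl -!scalemxAr QQ DQ !mulmxN !mulNmx DD opprK.
  have -> : c *: (c *: 1%:M) = (c ^+ 2)%:M :> 'M[R]_L by rewrite scalerA scalemx1 expr2.
  by rewrite DQ scalerN subrr -!raddfD /= dc [c ^+ 2 + _]addrC dc -scalar_mx_block.
pose e (s : 'I_(L + L)) := match fintype.split s with inl t => f t | inr t => g t end.
have eL t : e (lshift L t) = f t by rewrite /e (unsplitK (inl _ t)).
have eR t : e (rshift L t) = g t by rewrite /e (unsplitK (inr _ t)).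
have nfg t t' : f t != g t'.
  by apply: contraTneq (fs t) => ->; exact: gs.
have e_inj : injective e.
  move=> s s'; rewrite /e; case: (fintype.splitP s) => t ts; case: (fintype.splitP s') => t' ts' E.
  - by apply: val_inj; rewrite /= ts ts' (f_inj _ _ E).
  - by have := nfg t t'; rewrite E eqxx.
  - by have := nfg t' t; rewrite E eqxx.
  - by apply: val_inj; rewrite /= ts ts' (g_inj _ _ E).
pose X := embed e Y.
have Xff t t' : X (f t) (f t') = dl t *+ (t == t').
  by rewrite -!eL embed_in // block_mxEul !mxE.
have Xgg t t' : X (g t) (g t') = - (dl t *+ (t == t')).
  by rewrite -!eR embed_in // block_mxEdr !mxE.
have Xfg t t' : X (f t) (g t') = c * Q t t'.
  by rewrite -eL -eR embed_in // block_mxEur !mxE.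
have XT : X^T = X by exact: embed_sym.
have Xout a b : (forall t, a != f t) -> (forall t, a != g t) -> X a b = (a == b)%:R.
  by move=> af ag; apply: embed_out => s; rewrite /e; case: fintype.splitP => t _.
have slotP a : [\/ exists t, a = f t, exists t, a = g t |
    (forall t, a != f t) /\ (forall t, a != g t)].
  have [/existsP[t /eqP]|/existsPn af] := boolP [exists t, a == f t].
    by constructor 1; exists t.
  have [/existsP[t /eqP]|/existsPn ag] := boolP [exists t, a == g t]; last by constructor 3.
  by constructor 2; exists t.
have delta1 : delta ^+ 2 != 1.
  by apply: contraNneq c0 => d1; move/eqP: dc; rewrite d1 -subr_eq0 addrC addKr sqrf_eq0.
have dl1 t : dl t != 1 by apply: contraNneq delta1 => d1; rewrite -(dl2 t) d1 mulr1.
have dlN1 t : - dl t != 1 by apply: contraNneq delta1 => d1; rewrite -(dl2 t) -mulrNN d1 mulr1.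
have dl_col t t' : delta != 0 -> col t != col t' -> dl t != dl t'.
  move=> d0; have dN : delta != - delta by rewrite -addr_eq0 -mulr2n mulrn_eq0.
  by rewrite /dl; case: (col t) (col t') => [] [] //= _; rewrite // eq_sym.
have XX : X *m X = 1%:M by exact: embedK.
clearbody X; exists X; split=> //.
have Xdiag i lam a : clique_proj cl i *m X *m clique_proj cl i = lam *: clique_proj cl i ->
    cl a = i -> X a a = lam.
  move=> /matrixP/(_ a a) + ai; rewrite blockE ai eqxx /= => ->.
  by rewrite 3!mxE ai !eqxx mulr1n mulr1.
split=> [i j nij sij|i j nij|i lam sz1].
- apply/matrixP => a b; rewrite blockE mxE; case: ifP => // /andP[/eqP ai /eqP bj].
  have nab : a != b by apply: contraNneq nij => eab; rewrite -ai -bj eab.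
  have sab : side (cl a) = side (cl b) by rewrite ai bj.
  case: (slotP a) sab nab => [[t ->]|[t ->]|[af ag]]; last by rewrite Xout // => _ /negbTE->.
  + case: (slotP b) => [[t' ->] _ nab|[t' ->]|[bf bg] _ nab].
    * by rewrite Xff; case: (t =P t') nab => [->|_]; rewrite ?eqxx ?mulr0n.
    * by rewrite fs (negbTE (gs t')).
    * by rewrite -XT mxE Xout // eq_sym (negbTE nab).
  + case: (slotP b) => [[t' ->]|[t' ->] _ nab|[bf bg] _ nab].
    * by rewrite fs (negbTE (gs t)).
    * by rewrite Xgg; case: (t =P t') nab => [->|_]; rewrite ?eqxx ?mulr0n ?oppr0.
    * by rewrite -XT mxE Xout // eq_sym (negbTE nab).
- have X_neq0 i' j' : side i' -> ~~ side j' ->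
      clique_proj cl i' *m X *m clique_proj cl j' != 0.
    move=> si sj; have [t [t' [ti tj ctt]]] := share _ _ si sj.
    apply/eqP => /matrixP/(_ (f t) (g t')); rewrite blockE ti tj !eqxx Xfg mxE /= => /eqP.
    by rewrite mulf_eq0 (negbTE c0) /= -[_ == _]negbK Qcol ctt eqxx.
  have [si|si] := boolP (side i).
    by apply: X_neq0 => //; move: nij; rewrite si; case: (side j).
  have sj : side j by move: nij; rewrite (negbTE si); case: (side j).
  apply: contraNneq (X_neq0 j i sj si) => e0; apply/eqP; apply: trmx_inj.
  by rewrite trmx0 -e0 !trmx_mul XT !tr_diag_mx mulmxA.
- apply/eqP => /Xdiag Xlam; have [si|si] := boolP (side i).
    have [[t ti] [[a ai af]|[d0 [t1 [t2 [i1 i2 ct]]]]]] := mixf i si sz1.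
      have := Xlam _ ti; rewrite -(Xlam _ ai) Xff eqxx mulr1n Xout // ?eqxx.
        by move/eqP; rewrite (negbTE (dl1 t)).
      by move=> t'; apply: contraTneq si => E; rewrite -ai E gs.
    have := Xlam _ i1; rewrite -(Xlam _ i2) !Xff !eqxx !mulr1n => /eqP.
    by rewrite (negbTE (dl_col _ _ d0 ct)).
  have [[t ti] [[a ai ag]|[d0 [t1 [t2 [i1 i2 ct]]]]]] := mixg i si sz1.
    have := Xlam _ ti; rewrite -(Xlam _ ai) Xgg eqxx mulr1n Xout // ?eqxx.
      by move/eqP; rewrite (negbTE (dlN1 t)).
    by move=> t'; apply: contraNneq si => E; rewrite -ai E fs.
  have := Xlam _ i1; rewrite -(Xlam _ i2) !Xgg !eqxx !mulr1n => /oppr_inj/eqP.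
  by rewrite (negbTE (dl_col _ _ d0 ct)).
Qed.

End TwoEigenvalues.

(** One representative is chosen in each clique. With [u] and [v] the indicators of the
    representatives of the two sides, [u^T *m v + v^T *m u] has nonzero eigenvalues plus and minus
    [beta], the product of the lengths of [u] and [v]. Putting [beta] on the diagonal at the other
    vertices keeps the cubic identity and makes the larger diagonal blocks nonscalar. *)
Lemma three_eigenvalue_block_pattern (R : rcfType) N (I : finType) (cl : 'I_N -> I)
    (side : I -> bool) :
  (exists i, side i) -> (exists i, ~~ side i) -> (forall i, 0 < clique_size cl i)%N ->
  exists (beta : R) (X : 'M[R]_N),
    [/\ X^T = X, X *m X *m X = beta ^+ 2 *: X & block_pattern cl side X].
Proof.
move=> [i0 si0] [j0 sj0] sz0.
have /fin_all_exists[r clr] : forall i, exists a, cl a = i.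
  by move=> i; have /card_gt0P[a /eqP ai] := sz0 i; exists a.
pose rep a := a == r (cl a).
have repr i : rep (r i) by rewrite /rep clr.
pose x s : 'rV[R]_N := \row_a (rep a && (side (cl a) == s))%:R.
pose cnt s := #|[pred a | rep a && (side (cl a) == s)]|.
have cnt0 s : (0 < cnt s)%N.
  apply/card_gt0P; case: s; [exists (r i0) | exists (r j0)];
    by rewrite !inE repr clr ?si0 // (negbTE sj0).
have xx s s' : x s *m (x s')^T = (if s == s' then (cnt s)%:R else 0)%:M.
  rewrite [LHS]mx11_scalar; congr (_%:M); rewrite mxE.
  rewrite (eq_bigr (fun a => if s == s' then (rep a && (side (cl a) == s))%:R else 0)); last first.
    move=> a _; rewrite !mxE -natrM mulnb.
    by case: (rep a) (side (cl a)) s s' => [] [] [] [].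
  case: (s == s'); last by rewrite big1.
  by rewrite -natr_sum -big_mkcond sum1_card.
pose beta : R := Num.sqrt (cnt true * cnt false)%:R.
have beta2 : beta ^+ 2 = (cnt true)%:R * (cnt false)%:R by rewrite sqr_sqrtr ?ler0n // natrM.
have beta0 : beta != 0 by rewrite -sqrf_eq0 beta2 mulf_neq0 // pnatr_eq0 -lt0n.
pose D : 'M[R]_N := diag_mx (\row_a (~~ rep a)%:R).
have DT : D^T = D by exact: tr_diag_mx.
have DD : D *m D = D.
  by rewrite /D mulmx_diag; apply/matrixP => a b; rewrite !mxE -natrM mulnb andbb.
have xD s : x s *m D = 0.
  by apply/rowP => a; rewrite /D mul_mx_diag !mxE -natrM mulnb; case: (rep a); rewrite ?andbF.
have Dx s : D *m (x s)^T = 0 by rewrite -DT -trmx_mul xD trmx0.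
pose u := x true; pose v := x false.
have uu : u *m u^T = (cnt true)%:R%:M by rewrite xx.
have vv : v *m v^T = (cnt false)%:R%:M by rewrite xx.
have uv : u *m v^T = 0 by rewrite xx /= raddf0.
have vu : v *m u^T = 0 by rewrite xx /= raddf0.
pose X := u^T *m v + v^T *m u + beta *: D.
have XX : X *m X = (cnt false)%:R *: (u^T *m u) + (cnt true)%:R *: (v^T *m v) + beta ^+ 2 *: D.
  rewrite /X !(mulmxDl, mulmxDr) -!scalemxAl -!scalemxAr DD scalerA -expr2 -!mulmxA.
  rewrite !(mulmxA u) !(mulmxA v) !(mulmxA D) !xD !Dx uu vv uv vu.
  by rewrite !(mul0mx, mulmx0, scaler0, addr0, add0r) !mul_scalar_mx -!scalemxAr.
have XXX : X *m X *m X = beta ^+ 2 *: X.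
  rewrite XX {1}/X !(mulmxDl, mulmxDr) -!scalemxAl -!scalemxAr DD -!mulmxA.
  rewrite !(mulmxA u) !(mulmxA v) !(mulmxA D) !xD !Dx uu vv uv vu.
  rewrite !(mul0mx, mulmx0, scaler0, addr0, add0r) !mul_scalar_mx -!scalemxAr !scalerA.
  by rewrite /X !scalerDr scalerA beta2 [(cnt false)%:R * _]mulrC.
have XE a b : X a b = (rep a && side (cl a))%:R * (rep b && ~~ side (cl b))%:R +
    (rep a && ~~ side (cl a))%:R * (rep b && side (cl b))%:R + beta * ((~~ rep a)%:R *+ (a == b)).
  rewrite /X /u /v 2!mxE [X in X + _ + _]mxE [X in _ + X + _]mxE !big_ord1 !mxE.
  by rewrite !eqb_id !eqbF_neg.
have XT : X^T = X by rewrite /X !raddfD /= linearZ /= !trmx_mul !trmxK DT [X in X + _]addrC.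
clearbody X; exists beta, X; split=> //; split=> [i j nij sij|i j nij|i lam sz1].
- apply/matrixP => a b; rewrite blockE [RHS]mxE; case: ifP => // /andP[/eqP ai /eqP bj].
  have /negbTE nab : a != b by apply: contraNneq nij => eab; rewrite -ai -bj eab.
  rewrite XE ai bj sij nab mulr0n mulr0 addr0.
  by case: (side j); rewrite ?andbF ?mulr0 ?mul0r ?addr0 ?mulr0.
- apply/eqP => /matrixP/(_ (r i) (r j)); rewrite blockE !clr !eqxx [RHS]mxE /= XE !repr !clr.
  move: nij; case: (side i) (side j) => [] [] //= _ /eqP;
    by rewrite !(mulr1, mulr0, mul0r, add0r, mul0rn, addr0) oner_eq0.
- have /card_gt1P[a [b [/eqP ai /eqP bi nab]]] := sz1.
  have [c ci nrc] : exists2 c, cl c = i & ~~ rep c.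
    have [ra|] := boolP (rep a); last by exists a.
    by exists b => //; rewrite /rep bi -ai -(eqP ra) eq_sym.
  apply/eqP => /matrixP E; have := E c c; have := E (r i) (r i).
  rewrite !blockE clr ci eqxx /= !XE !repr (negbTE nrc) !mxE clr ci !eqxx /=.
  rewrite !(mulr1, mulr0, mul0r, add0r, mul0rn, mulr1n, addr0) => e1 e2.
  by move/eqP: beta0; apply; rewrite e2 -e1; case: (side i); rewrite /= ?mulr0 ?mul0r ?addr0.
Qed.

(** * Numbers of eigenvalues *)

Lemma spectrum_seq (R : realType) N (A : 'M[R]_N) :
  exists s : seq R, [/\ uniq s, size s = num_eigenvalues A &
    forall a, (a \in s) = eigenvalue A a].
Proof.
exists (fset_set (spectrum A)); split=> [|//|a]; first exact: fset_uniq.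
rewrite in_fset_set; last exact: finite_spectrum.
exact: asboolb.
Qed.

Section Spectrum.
Context {R : realType} {N : nat}.
Implicit Types A X : 'M[R]_N.

(** Serves to prove polynomial identities in a symmetric [A] by checking them on eigenvectors. *)
Lemma symmetric_annihilated A M : A^T = A ->
  (forall a (w : 'rV_N), eigenvalue A a -> w *m A = a *: w -> w *m M = 0) -> M = 0 :> 'M_N.
Proof.
move=> symA H; apply/eqP; apply: contraT => M0.
have [a [w [wA wM]]] := symmetric_eigenvectors_separate symA M0.
have w0 : w != 0 by apply: contraNneq wM => ->; rewrite mul0mx.
by rewrite (H a) ?eqxx // in wM; apply/eigenvalueP; exists w.
Qed.

Lemma num_eigenvalues_gt1 A a b : A^T = A -> a != b -> A a b != 0 ->
  (1 < num_eigenvalues A)%N.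
Proof.
move=> symA nab Aab; have [s [_ <- sE]] := spectrum_seq A.
(* The default 0 is harmless: with an empty spectrum the condition on eigenvectors is vacuous. *)
rewrite ltnNge; apply/negP => s1; pose x := head 0 s.
suff /matrixP/(_ a b)/eqP : A - x%:M = 0.
  by rewrite !mxE (negbTE nab) mulr0n subr0 (negbTE Aab).
apply: symmetric_annihilated symA _ => y w; rewrite -sE => ys wA.
have -> : x = y by move: s1 ys; rewrite /x; case: (s) => [|z [|? ?]] //= _; rewrite inE => /eqP->.
by rewrite mulmxBr mul_mx_scalar wA subrr.
Qed.

Lemma num_eigenvalues_involution X a b : X *m X = 1%:M -> a != b -> X a b != 0 ->
  (num_eigenvalues X <= 2)%N.
Proof.
move=> XX nab Xab; have [s [us <- sE]] := spectrum_seq X.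
apply: (uniq_leq_size (s2 := [:: 1; -1]) us) => x; rewrite sE => /eigenvalueP[w wX w0].
have : (x * x - 1) *: w == 0.
  by rewrite scalerBl scale1r -scalerA -wX scalemxAl -wX -mulmxA XX mulmx1 subrr.
by rewrite scaler_eq0 (negbTE w0) orbF -expr2 subr_sqr_1 mulf_eq0 subr_eq0 addr_eq0 !inE.
Qed.

Lemma num_eigenvalues_cubic X beta : X *m X *m X = beta ^+ 2 *: X ->
  (num_eigenvalues X <= 3)%N.
Proof.
move=> XXX; have [s [us <- sE]] := spectrum_seq X.
apply: (uniq_leq_size (s2 := [:: 0; beta; -beta]) us) => x.
rewrite sE => /eigenvalueP[w wX w0].
have : (x * (x ^+ 2 - beta ^+ 2)) *: w == 0.
  have e : w *m (X *m X *m X) = (x * x * x) *: w.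
    by rewrite !mulmxA wX -!scalemxAl wX -scalemxAl wX !scalerA.
  rewrite XXX -scalemxAr wX scalerA in e.
  by rewrite mulrBr scalerBl [x * beta ^+ 2]mulrC e expr2 mulrA subrr.
by rewrite scaler_eq0 (negbTE w0) orbF subr_sqr !mulf_eq0 subr_eq0 addr_eq0 !inE.
Qed.

(** The affine map sending the two eigenvalues to 1 and -1 only rescales the off-diagonal
    entries. *)
Lemma num_eigenvalues2_involution (I : finType) (cl : 'I_N -> I) (side : I -> bool) A :
  A^T = A -> join_pattern cl side A -> num_eigenvalues A = 2%N ->
  exists X : 'M[R]_N, [/\ X^T = X, X *m X = 1%:M & join_pattern cl side X].
Proof.
move=> symA patA; have [s [us <- sE]] := spectrum_seq A.
case: s us sE => [|x [|y [|? ?]]] //=; rewrite inE andbT => nxy sE _.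
have xy0 : x - y != 0 by rewrite subr_eq0.
have E : A *m A = (x + y) *: A - (x * y)%:M.
  suff /eqP : A *m A - ((x + y) *: A - (x * y)%:M) = 0 by rewrite subr_eq0 => /eqP.
  apply: symmetric_annihilated symA _ => z w; rewrite -sE !inE => zxy wA.
  rewrite !mulmxBr mulmxA -scalemxAr mul_mx_scalar wA -scalemxAl wA !scalerA -!scalerBl.
  by case/orP: zxy => /eqP->; rewrite (_ : _ - _ = 0) ?scale0r //; ring.
exists ((2 / (x - y)) *: A - ((x + y) / (x - y))%:M); split.
- by rewrite linearB linearZ /= symA tr_scalar_mx.
- rewrite mulmxBl !mulmxBr mul_mx_scalar mul_scalar_mx -!scalemxAl -!scalemxAr E.
  apply/matrixP => a b; rewrite -scalar_mxM !mxE.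
  by case: (a == b); rewrite ?mulr1n ?mulr0n; field.
- move=> a b nab; rewrite -patA // !mxE (negbTE nab) mulr0n subr0 mulf_eq0 negb_or.
  by rewrite mulf_neq0 ?invr_eq0 ?pnatr_eq0.
Qed.

End Spectrum.

(** * Joins of unions of complete graphs *)

Lemma mulmx_conjM (F : pzRingType) N (H Y Z : 'M[F]_N) : H *m H = 1%:M ->
  (H *m Y *m H) *m (H *m Z *m H) = H *m (Y *m Z) *m H.
Proof. by move=> HH; rewrite !mulmxA -(mulmxA _ H H) HH mulmx1. Qed.

Section Join.
Context (R : realType) (k l : nat) (m : 'I_k -> nat) (n : 'I_l -> nat).

Definition join_cliques : sgraph := graph_join (union_complete m) (union_complete n).
Local Notation G := join_cliques.

Definition clique_of_vertex (x : G) : 'I_k + 'I_l :=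
  match x with inl u => inl (tag u) | inr u => inr (tag u) end.

Definition clique_of (a : 'I_#|G|) : 'I_k + 'I_l := clique_of_vertex (enum_val a).

Definition left_side (i : 'I_k + 'I_l) : bool := if i is inl _ then true else false.

Lemma dunion_complete_adj q (p : 'I_q -> nat) (u v : union_complete p) :
  u != v -> adj u v = (tag u == tag v).
Proof.
case: u v => [i x] [j y] nuv; rewrite /adj /= /dunion_adj /=.
have [eij|//] := eqVneq i j; subst j; rewrite tagged_asE /= /complete_adj /=.
by apply: contraNneq nuv => ->.
Qed.

Lemma join_adjE (a b : 'I_#|G|) : a != b ->
  adj (enum_val a) (enum_val b) = clique_adj clique_of left_side a b.
Proof.
rewrite -(inj_eq enum_val_inj) /clique_adj /clique_of.
case: (enum_val a) (enum_val b) => [u|u] [v|v] //= nuv; rewrite orbF.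
  by rewrite [LHS](@dunion_complete_adj _ _ u v).
by rewrite [LHS](@dunion_complete_adj _ _ u v).
Qed.

Lemma graph_matricesE (A : 'M[R]_#|G|) :
  graph_matrices R G A <-> A^T = A /\ join_pattern clique_of left_side A.
Proof.
by split=> -[symA patA]; split=> // a b nab; rewrite patA // join_adjE.
Qed.

Lemma clique_size_left i : clique_size clique_of (inl i) = m i.
Proof.
pose f (p : 'I_(m i)) : 'I_#|G| := enum_rank (inl (Tagged (fun j => complete_graph (m j)) p) : G).
have f_inj : injective f.
  by move=> p p' /enum_rank_inj[] /eqP; rewrite -tag_eqE /tag_eq eqxx tagged_asE => /eqP.
rewrite -[RHS]card_ord -(card_codom f_inj); apply: eq_card => a; rewrite !inE /clique_of.
apply/idP/codomP => [|[p ->]]; last by rewrite enum_rankK /= eqxx.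
case E : (enum_val a) => [[j p]|//] /= /eqP[ej]; subst j.
by exists p; apply: enum_val_inj; rewrite E enum_rankK.
Qed.

Lemma clique_size_right j : clique_size clique_of (inr j) = n j.
Proof.
pose f (p : 'I_(n j)) : 'I_#|G| := enum_rank (inr (Tagged (fun i => complete_graph (n i)) p) : G).
have f_inj : injective f.
  by move=> p p' /enum_rank_inj[] /eqP; rewrite -tag_eqE /tag_eq eqxx tagged_asE => /eqP.
rewrite -[RHS]card_ord -(card_codom f_inj); apply: eq_card => a; rewrite !inE /clique_of.
apply/idP/codomP => [|[p ->]]; last by rewrite enum_rankK /= eqxx.
case E : (enum_val a) => [//|[i p]] /= /eqP[ei]; subst i.
by exists p; apply: enum_val_inj; rewrite E enum_rankK.
Qed.

Context (k_gt0 : (0 < k)%N) (l_gt0 : (0 < l)%N).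
Context (m_gt0 : forall i, (0 < m i)%N) (n_gt0 : forall j, (0 < n j)%N).

Lemma clique_size_gt0 i : (0 < clique_size clique_of i)%N.
Proof. by case: i => i; rewrite ?clique_size_left ?clique_size_right. Qed.

Let i0 : 'I_k := Ordinal k_gt0.
Let j0 : 'I_l := Ordinal l_gt0.

Lemma cross_pair : exists a b, a != b /\ clique_adj clique_of left_side a b.
Proof.
have /card_gt0P[a /eqP ai] := clique_size_gt0 (inl i0).
have /card_gt0P[b /eqP bj] := clique_size_gt0 (inr j0).
exists a, b; split; last by rewrite /clique_adj ai bj.
by apply/eqP => eab; rewrite -eab ai in bj.
Qed.

Lemma min_num_eigenvalues_ge2 : (1 < min_num_eigenvalues R G)%N.
Proof.
rewrite /min_num_eigenvalues; case: ex_minnP => r /asboolP[A /graph_matricesE[symA patA] <-] _.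
have [a [b [nab ab]]] := cross_pair.
by apply: (num_eigenvalues_gt1 symA nab); rewrite patA.
Qed.

Lemma min_num_eigenvalues_le r (A : 'M[R]_#|G|) :
  A^T = A -> join_pattern clique_of left_side A -> (num_eigenvalues A <= r)%N ->
  (min_num_eigenvalues R G <= r)%N.
Proof.
move=> symA patA; apply: leq_trans; rewrite /min_num_eigenvalues.
case: ex_minnP => r0 _; apply; apply/asboolP; exists A => //.
exact/graph_matricesE.
Qed.

Lemma min_num_eigenvalues_le3 : (min_num_eigenvalues R G <= 3)%N.
Proof.
have [||| beta [X [symX XXX bpX]]] :=
    @three_eigenvalue_block_pattern R _ _ clique_of left_side.
- by exists (inl i0).
- by exists (inr j0).
- exact: clique_size_gt0.
have [||| |Y [symY YYY patY]] := @exists_join_pattern _ _ _ clique_of left_side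
    (fun Y => Y *m Y *m Y = beta ^+ 2 *: Y) X.
- by move=> Y H YYY _ HH; rewrite !mulmx_conjM // YYY -scalemxAr -scalemxAl.
- exact: symX.
- exact: XXX.
- exact: bpX.
exact: min_num_eigenvalues_le symY patY (num_eigenvalues_cubic YYY).
Qed.

(** Relaxing the exact pattern to [block_pattern] loses nothing, since conjugation by reflections
    restores it within the involutions. *)
Lemma min_num_eigenvalues_eq2 : min_num_eigenvalues R G = 2%N <->
  exists X : 'M[R]_#|G|, [/\ X^T = X, X *m X = 1%:M & block_pattern clique_of left_side X].
Proof.
split=> [q2|[X [symX XX bpX]]].
  have : attains_num_eigenvalues R G (min_num_eigenvalues R G).
    by rewrite /min_num_eigenvalues; case: ex_minnP.
  rewrite q2 => /asboolP[A /graph_matricesE[symA patA] num2].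
  have [X [symX XX patX]] := num_eigenvalues2_involution symA patA num2.
  exists X; split=> //; apply: join_pattern_block patX; exact: clique_size_gt0.
have [||| |Y [symY YY patY]] := @exists_join_pattern _ _ _ clique_of left_side
    (fun Y => Y *m Y = 1%:M) X.
- by move=> Y H YY _ HH; rewrite mulmx_conjM // YY mulmx1.
- exact: symX.
- exact: XX.
- exact: bpX.
apply/eqP; rewrite eqn_leq min_num_eigenvalues_ge2 andbT.
have [a [b [nab ab]]] := cross_pair.
apply: (min_num_eigenvalues_le symY patY).
by apply: (num_eigenvalues_involution YY nab); rewrite patY.
Qed.

End Join.

(** * Conditions on the clique sizes *)

Lemma sum_left_side k l (F : 'I_k + 'I_l -> nat) :
  (\sum_(i | left_side i == true) F i = \sum_(i < k) F (inl i))%N.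
Proof. by rewrite big_sumType /= [X in (_ + X)%N]big_pred0 ?addn0. Qed.

Lemma sum_right_side k l (F : 'I_k + 'I_l -> nat) :
  (\sum_(i | left_side i != true) F i = \sum_(j < l) F (inr j))%N.
Proof. by rewrite big_sumType /= big_pred0. Qed.

(** Termwise, [m i - (1 < m i) + 1] is [m i + (m i == 1)]. *)
Lemma sum_reduced k (m : 'I_k -> nat) : (forall i, 0 < m i)%N ->
  (\sum_(i < k) (m i - (1 < m i)) + k = weight m + num_ones m)%N.
Proof.
move=> m0; have -> : num_ones m = (\sum_i (m i == 1))%N.
  rewrite /num_ones cardsE -sum1_card big_mkcond.
  by apply: eq_bigr => i _; rewrite unfold_in; case: (m i) => [|[|p]].
have kE : k = (\sum_(i < k) 1)%N by rewrite sum1_card card_ord.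
rewrite [X in (_ + X)%N]kE -!big_split /=.
by apply: eq_bigr => i _; case: (m i) (m0 i) => [|[|p]] //= _; rewrite subn1 addn1 addn0.
Qed.

Section Conditions.
Context (R : realType) (k l : nat) (m : 'I_k -> nat) (n : 'I_l -> nat).
Context (k_gt0 : (0 < k)%N) (l_gt0 : (0 < l)%N).
Context (m_gt0 : forall i, (0 < m i)%N) (n_gt0 : forall j, (0 < n j)%N).
Local Notation G := (join_cliques m n).
Local Notation cl := (@clique_of k l m n).
Local Notation side := (@left_side k l).

Lemma join_involution_necessity (X : 'M[R]_#|G|) :
  X^T = X -> X *m X = 1%:M -> block_pattern cl side X ->
  [/\ (l <= weight m)%N,
      (0 < num_ones m -> k + l <= weight m + num_ones m)%N &
      (k + l <= weight m + num_ones m)%N \/ (2 * k <= weight n)%N].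
Proof.
move=> symX XX bpX.
have [||] := involution_necessity symX XX bpX (s := true).
- by exists (inl (Ordinal k_gt0)).
- by exists (inr (Ordinal l_gt0)).
have -> : #|[pred i | side i != true]| = l by rewrite -sum1_card sum_right_side sum1_card card_ord.
have -> : #|[pred i | side i == true]| = k by rewrite -sum1_card sum_left_side sum1_card card_ord.
have -> : (\sum_(i | side i == true) clique_size cl i = weight m)%N.
  by rewrite sum_left_side; apply: eq_bigr => i _; exact: clique_size_left.
have -> : (\sum_(i | side i != true) clique_size cl i = weight n)%N.
  by rewrite sum_right_side; apply: eq_bigr => i _; exact: clique_size_right.
have redE := sum_reduced m_gt0.
have -> : (\sum_(i | side i == true) (clique_size cl i - (1 < clique_size cl i)) =
           \sum_(i < k) (m i - (1 < m i)))%N.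
  by rewrite sum_left_side; apply: eq_bigr => i _; rewrite clique_size_left.
move=> lm ones red; split=> // [|]; last by case: red; [left|right]; lia.
rewrite {1}/num_ones => /card_gt0P[x]; rewrite inE => /eqP mx1.
rewrite -redE addnC leq_add2r; apply: ones.
by exists (inl x); rewrite // clique_size_left.
Qed.

(* [v] and [w] count the interior eigenvalues of the blocks: all of them 0, or,
   when [alternate] holds, alternately 3/5 and -3/5. *)
Lemma join_slots_involution L (v : 'I_k -> nat) (w : 'I_l -> nat) (alternate : bool) :
  (forall i, 0 < v i <= m i)%N -> (forall j, 0 < w j <= n j)%N ->
  (\sum_i v i = L)%N -> (\sum_j w j = L)%N ->
  (forall i, 1 < m i -> if alternate then 1 < v i else v i < m i)%N ->
  (forall j, 1 < n j -> w j < n j \/ alternate && (1 < w j))%N ->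
  (alternate -> forall i, 1 < m i)%N ->
  exists X : 'M[R]_#|G|, [/\ X^T = X, X *m X = 1%:M & block_pattern cl side X].
Proof.
move=> vb wb vL wL mixm mixn alt_m.
have [f [f_inj fP]] := exists_slots (fun i => proj2 (andP (vb i))) vL.
have [g [g_inj gP]] := exists_slots (fun j => proj2 (andP (wb j))) wL.
pose F t : 'I_#|G| := enum_rank (inl (f t) : G).
pose H t : 'I_#|G| := enum_rank (inr (g t) : G).
have clF t : cl (F t) = inl (tag (f t)) by rewrite /clique_of enum_rankK.
have clH t : cl (H t) = inr (tag (g t)) by rewrite /clique_of enum_rankK.
(* [(3/5, 4/5)] is a rational point of the unit circle; [delta] must be nonzero to tell the two
   colours apart. *)
pose delta : R := if alternate then 3 / 5 else 0.
pose c : R := if alternate then 4 / 5 else 1.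
pose col (t : 'I_L) := alternate && odd t.
have mixedF i : (1 < m i)%N -> mixed cl col delta F (inl i).
  move=> mi; have [v0 v1 vm] := fP i; split.
    have [|t ti] := v0; first by case/andP: (vb i).
    by exists t; rewrite clF ti.
  move: (mixm i mi); rewrite /delta /col; case: (alternate) => [/v1 vodd|/vm[x xi xf]].
    right; split; first by rewrite mulf_neq0 ?invr_eq0 ?pnatr_eq0.
    have [t ti to] := vodd true; have [t' ti' to'] := vodd false.
    by exists t, t'; rewrite !clF ti ti' to to'.
  left; exists (enum_rank (inl x : G)); first by rewrite /clique_of enum_rankK /= xi.
  move=> t; rewrite (inj_eq enum_rank_inj); apply: contraNneq (xf t); by case=> ->.
have mixedH j : (1 < n j)%N -> mixed cl col delta H (inr j).
  move=> nj; have [w0 w1 wn] := gP j; split.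
    have [|t tj] := w0; first by case/andP: (wb j).
    by exists t; rewrite clH tj.
  case: (mixn j nj) => [/wn[x xj xg]|/andP[alt /w1 wodd]].
    left; exists (enum_rank (inr x : G)); first by rewrite /clique_of enum_rankK /= xj.
    move=> t; rewrite (inj_eq enum_rank_inj); apply: contraNneq (xg t); by case=> ->.
  right; rewrite /delta /col alt; split; first by rewrite mulf_neq0 ?invr_eq0 ?pnatr_eq0.
  have [t tj to] := wodd true; have [t' tj' to'] := wodd false.
  by exists t, t'; rewrite !clH tj tj' to to'.
apply: (@slots_involution R _ _ L cl side F H col delta c).
- by rewrite /delta /c; case: (alternate); field.
- by rewrite /c; case: (alternate); rewrite ?oner_eq0 // mulf_neq0 ?invr_eq0 ?pnatr_eq0.
- by move=> t t' /enum_rank_inj[] /f_inj.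
- by move=> t t' /enum_rank_inj[] /g_inj.
- by move=> t; rewrite clF.
- by move=> t; rewrite clH.
(* When the colours alternate, clique [i] has slots of both parities, so one matches the colour of
   any slot of clique [j]. *)
- move=> [i|//] [//|j] _ _; have [v0 v1 _] := fP i; have [w0 _ _] := gP j.
  have [|t' tj] := w0; first by case/andP: (wb j).
  have [alt|nalt] := boolP alternate.
    have [|t ti to] := v1 _ (odd t'); first by have := mixm i (alt_m alt i); rewrite alt.
    by exists t, t'; rewrite clF clH ti tj /col to.
  have [|t ti] := v0; first by case/andP: (vb i).
  by exists t, t'; rewrite clF clH ti tj /col (negbTE nalt).
- by move=> [i|//] _; rewrite clique_size_left => /mixedF.
- by move=> [//|j] _; rewrite clique_size_right => /mixedH.
Qed.

(** Every clique of [n] gets one slot, so there are [l] in all. On both sides each clique of size at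
    least 2 keeps a free vertex, which leaves [weight m + num_ones m - k] places in the cliques of
    [m]. *)
Lemma join_involution_single : (k <= l)%N -> (k + l <= weight m + num_ones m)%N ->
  exists X : 'M[R]_#|G|, [/\ X^T = X, X *m X = 1%:M & block_pattern cl side X].
Proof.
move=> le_kl leL; have sumr := sum_reduced m_gt0.
have [|| v [vb vL]] := @exists_sum_between _ (fun=> 1%N) (fun i => m i - (1 < m i))%N l.
- by move=> i; have := m_gt0 i; case: (m i) => [|[|p]].
- by rewrite sum1_card card_ord le_kl -(leq_add2r k) sumr addnC.
apply: (@join_slots_involution l v (fun=> 1%N) false) => //=.
- by move=> i; have /andP[-> le] := vb i; apply: leq_trans le (leq_subr _ _).
- by rewrite sum1_card card_ord.
- by move=> i mi; have := vb i; rewrite mi subn1; lia.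
- by move=> j nj; left.
Qed.

(** Every clique of [m] gets at least two slots, hence both colours. The number of slots is the
    larger of [l] and [2 * k]: in the first case each clique of [n] has one, in the second each
    clique of [m] has exactly two. *)
Lemma join_involution_double : (forall i, 1 < m i)%N ->
  (2 * k <= l <= weight m)%N || (l <= 2 * k <= weight n)%N ->
  exists X : 'M[R]_#|G|, [/\ X^T = X, X *m X = 1%:M & block_pattern cl side X].
Proof.
move=> m1 /orP[lL|lL].
  have [||v [vb vL]] := @exists_sum_between _ (fun=> 2%N) m l; first exact: m1.
    by rewrite sum_nat_const card_ord mulnC.
  apply: (@join_slots_involution l v (fun=> 1%N) true) => //=.
  - by move=> i; have := vb i; lia.
  - by rewrite sum1_card card_ord.
  - by move=> i _; case/andP: (vb i).
  - by move=> j nj; left.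
have [||w [wb wL]] := @exists_sum_between _ (fun=> 1%N) n (2 * k)%N; first exact: n_gt0.
  by rewrite sum1_card card_ord.
apply: (@join_slots_involution (2 * k) (fun=> 2%N) w true) => //=.
- by rewrite sum_nat_const card_ord mulnC.
(* A clique of [n] keeps a free vertex or, being filled by at least two slots, has both colours. *)
- move=> j nj; have := wb j; case: (ltnP (w j) (n j)) => wn; first by left.
  by right; lia.
Qed.

End Conditions.

Local Close Scope ring_scope.

Theorem theorem4p19 (R : realType) (k l : nat)
    (m : 'I_k -> nat) (n : 'I_l -> nat)
    (k_gt0 : 0 < k) (le_kl : k <= l)
    (m_gt0 : forall i, 0 < m i) (n_gt0 : forall j, 0 < n j) :
  let q := min_num_eigenvalues R (graph_join (union_complete m) (union_complete n)) in
  let a := [/\ num_ones m = 0, num_ones n = 0 & l <= weight m] in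
  let b := 0 < num_ones m /\ k + l <= weight m + num_ones m in
  let c := [/\ num_ones m = 0, 0 < num_ones n &
               [\/ k + l <= weight m,
                   2 * k <= l <= weight m |
                   l <= 2 * k <= weight n]] in
  (q = 2 <-> [\/ a, b | c]) /\ (~ [\/ a, b | c] -> q = 3).
Proof.
move=> q a b c; have l_gt0 : 0 < l := leq_trans k_gt0 le_kl.
have eq2 : q = 2 <-> [\/ a, b | c].
  apply: (iff_trans (min_num_eigenvalues_eq2 R k_gt0 l_gt0 m_gt0 n_gt0)); split.
    move=> [X [symX XX bpX]].
    have [lm ones red] := join_involution_necessity k_gt0 l_gt0 m_gt0 symX XX bpX.
    rewrite /a /b /c; case: (posnP (num_ones m)) => [m1|m1]; last by constructor 2; auto.
    case: (posnP (num_ones n)) => [n1|n1]; first by constructor 1.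
    constructor 3; split=> //; rewrite m1 addn0 in red.
    case: red => [?|kn]; first by constructor 1.
    (* Comparing [l] with [2 * k] decides the alternative; the upper bounds are [lm] and [kn]. *)
    by case: (leqP (2 * k) l) => ?; [constructor 2 | constructor 3]; lia.
  have ones0 p (h : 'I_p -> nat) : (forall i, 0 < h i) -> num_ones h = 0 -> forall i, 1 < h i.
    move=> h0 /eqP; rewrite cards_eq0 => /eqP h1 i; rewrite ltn_neqAle h0 andbT eq_sym.
    by apply/negP => hi; have := finset.in_set0 i; rewrite -h1 inE hi.
  case=> [[m1 n1 lm]|[m1 kl]|[m1 _ [kl|kl|kl]]].
  - apply: join_involution_double => //; first exact: ones0.
    (* As the cliques of [n] have size at least 2, [2 * k <= 2 * l <= weight n], so one of the two
       alternatives holds. *)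
    have : l * 2 <= weight n.
      rewrite /weight -[l in l * 2]card_ord -sum_nat_const; apply: leq_sum => j _; exact: ones0.
    by lia.
  - exact: join_involution_single.
  - by apply: join_involution_single => //; rewrite m1 addn0.
  - by apply: join_involution_double => //; [exact: ones0 | rewrite kl].
  - by apply: join_involution_double => //; [exact: ones0 | rewrite kl orbT].
split=> // nabc; have := min_num_eigenvalues_le3 R k_gt0 l_gt0 m_gt0 n_gt0.
have := min_num_eigenvalues_ge2 R k_gt0 l_gt0 m_gt0 n_gt0.
have : q <> 2 by move=> /eq2.
by rewrite -/q; lia.
Qed.
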